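(* Let $(\mathfrak{h},B_{\mathfrak{h}})$ be a semi-simple real Lie algebra of compact type endowed with an $\mathrm{ad}_{\mathfrak{h}}$-invariant Euclidean product, and let $\mathfrak{m}$ be a faithful irreducible real representation of $\mathfrak{h}$ of complex type. Consider the representation of $\mathfrak{h}\oplus\mathfrak{u}(1)$ on $\mathfrak{m}$ induced by the complex structure. If $\dim_{\mathbb{R}}(\Lambda^4\mathfrak{m})^{\mathfrak{h}\oplus\mathfrak{u}(1)}=1$, then there exists a unique positive real number $r$ such that $\mathfrak{m}$ is an $s$-representation of $\mathfrak{h}\oplus\mathfrak{u}(1)$ with respect to the scalar product $B_{\mathfrak{h}}+rB_{\mathfrak{u}(1)}$, where $B_{\mathfrak{u}(1)}$ is the scalar product on $\mathfrak{u}(1)$ satisfying $B_{\mathfrak{u}(1)}(\mathfrak{i},\mathfrak{i})=1$ for the generator $\mathfrak{i}$ of $\mathfrak{u}(1)$.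
   Context: A real Lie algebra of compact type means a finite-dimensional real Lie algebra admitting an $\mathrm{ad}$-invariant Euclidean product. An irreducible real representation $\rho:\mathfrak{h}\to\mathrm{End}(\mathfrak{m})$ is of complex type if the centralizer of $\rho(\mathfrak{h})$ in $\mathrm{End}_{\mathbb{R}}(\mathfrak{m})$ is isomorphic to $\mathbb{C}$; then there is an $\mathfrak{h}$-invariant complex structure $I$ on $\mathfrak{m}$ ($I^2=-\mathrm{id}$), and $\rho$ is extended to $\mathfrak{h}\oplus\mathfrak{u}(1)$ by $\rho(\mathfrak{i})=I$. $\Lambda^4\mathfrak{m}$ is the fourth exterior power over $\mathbb{R}$, and $(\cdot)^{\mathfrak{h}\oplus\mathfrak{u}(1)}$ denotes the subspace of invariant elements. Definition ($s$-representation). Let $(\mathfrak{k},B_{\mathfrak{k}})$ be a real Lie algebra of compact type with $\mathrm{ad}$-invariant Euclidean product and $\mathfrak{m}$ an irreducible real representation of $\mathfrak{k}$ with $\mathfrak{k}$-invariant Euclidean product $B_{\mathfrak{m}}$ (unique up to a positive constant). On $\mathfrak{g}:=\mathfrak{k}\oplus\mathfrak{m}$ there is a unique skew-symmetric $\mathbb{R}$-bilinear bracket such that (1) it restricts to the Lie bracket on $\mathfrak{k}$; (2) $[a,v]=-[v,a]=av$ for $a\in\mathfrak{k}$, $v\in\mathfrak{m}$; (3) $[\mathfrak{m},\mathfrak{m}]\subset\mathfrak{k}$; (4) $B_{\mathfrak{k}}(a,[v,w])=B_{\mathfrak{m}}(av,w)$ for $a\in\mathfrak{k}$, $v,w\in\mathfrak{m}$.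 The representation $\mathfrak{m}$ is an $s$-representation of $(\mathfrak{k},B_{\mathfrak{k}})$ if this bracket satisfies the Jacobi identity (a condition independent of the scaling of $B_{\mathfrak{m}}$). *)

(* Defs.v *)
From HB Require Import structures.
From mathcomp Require Import all_boot all_order all_fingroup all_algebra.
From mathcomp Require Import complex.
From mathcomp Require Import reals.

Set Implicit Arguments.
Unset Strict Implicit.
Unset Printing Implicit Defensive.

Import Order.TTheory GRing.Theory Num.Theory.

Local Open Scope ring_scope.

HB.mixin Record Vector_isLieAlgebra (R : fieldType) V of Vector R V := {
  lie : V -> V -> V;
  lie_linearl : forall z, linear (lie^~ z);
  lie_linearr : forall x, linear (lie x);
  liexx : forall x, lie x x = 0;
  lie_jacobi : forall x y z,
    lie x (lie y z) + lie y (lie z x) + lie z (lie x y) = 0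
}.

#[short(type="lieAlgType")]
HB.structure Definition LieAlgebra (R : fieldType) :=
  { V of Vector R V & Vector_isLieAlgebra R V }.

Section Product.
Variables (R : fieldType) (g1 g2 : lieAlgType R).

Definition prod_lie (x y : g1 * g2) : g1 * g2 := (lie x.1 y.1, lie x.2 y.2).

Fact prod_lie_linearl z : linear (prod_lie^~ z).
Proof.
by move=> a x y; rewrite /prod_lie /= (lie_linearl z.1) (lie_linearl z.2).
Qed.

Fact prod_lie_linearr x : linear (prod_lie x).
Proof.
by move=> a y z; rewrite /prod_lie /= (lie_linearr x.1) (lie_linearr x.2).
Qed.

Fact prod_liexx x : prod_lie x x = 0.
Proof. by rewrite /prod_lie !liexx. Qed.

Fact prod_lie_jacobi x y z :
  prod_lie x (prod_lie y z) + prod_lie y (prod_lie z x)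
    + prod_lie z (prod_lie x y) = 0.
Proof.
rewrite /prod_lie /=; apply/eqP; rewrite xpair_eqE /=.
by rewrite !lie_jacobi !eqxx.
Qed.

HB.instance Definition _ := Vector_isLieAlgebra.Build R (g1 * g2)%type
  prod_lie_linearl prod_lie_linearr prod_liexx prod_lie_jacobi.

End Product.

(* The real number [t] stands for [t] times the generator of u(1). *)
Definition u1 (R : fieldType) : Type := R^o.

Section U1.
Variable R : fieldType.
HB.instance Definition _ := Vector.copy (u1 R) R^o.

Definition u1_lie (x y : u1 R) : u1 R := 0.
Fact u1_lie_linearl z : linear (u1_lie^~ z).
Proof. by move=> a x y; rewrite /u1_lie scaler0 addr0. Qed.
Fact u1_lie_linearr x : linear (u1_lie x).
Proof. by move=> a y z; rewrite /u1_lie scaler0 addr0. Qed.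
Fact u1_liexx x : u1_lie x x = 0.
Proof. by []. Qed.
Fact u1_lie_jacobi x y z :
  u1_lie x (u1_lie y z) + u1_lie y (u1_lie z x) + u1_lie z (u1_lie x y) = 0.
Proof. by rewrite /u1_lie !addr0. Qed.

HB.instance Definition _ := Vector_isLieAlgebra.Build R (u1 R)
  u1_lie_linearl u1_lie_linearr u1_liexx u1_lie_jacobi.

Definition u1_coef (x : u1 R) : R := x.

End U1.

Section Semisimple.
Variables (R : fieldType) (g : lieAlgType R).

Definition is_ideal (U : {vspace g}) : Prop :=
  forall x u, u \in U -> lie x u \in U.

Definition lie_derived (U : {vspace g}) : {vspace g} :=
  <<[seq lie u v | u <- vbasis U, v <- vbasis U]>>%VS.

Definition is_solvable (U : {vspace g}) : Prop :=
  exists n, iter n lie_derived U = 0%VS.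

Definition is_semisimple : Prop :=
  forall U, is_ideal U -> is_solvable U -> U = 0%VS.

End Semisimple.

Section Representations.
Variables (R : fieldType) (g : lieAlgType R) (V : vectType R).
Implicit Type rho : g -> 'End(V).

Record is_rep rho : Prop := IsRep {
  rep_linear : linear rho;
  rep_lie : forall x y,
    rho (lie x y) = (rho x \o rho y)%VF - (rho y \o rho x)%VF
}.

Definition is_faithful rho : Prop := injective rho.

Definition is_irreducible rho : Prop :=
  (0 < \dim {:V})%N /\
  forall U : {vspace V}, (forall x, (rho x @: U <= U)%VS) ->
    U = 0%VS \/ U = fullv.

Definition centralizes rho (f : 'End(V)) : Prop :=
  forall x, (f \o rho x)%VF = (rho x \o f)%VF.

Definition is_invariant_complex_structure rho (I : 'End(V)) : Prop :=
  centralizes rho I /\ (I \o I)%VF = - \1%VF.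

Definition invariants rho : {vspace V} :=
  (\bigcap_(i < \dim {:g}) lker (rho (vbasis {:g})`_i))%VS.

Lemma invariantsP rho (v : V) : linear rho ->
  reflect (forall x, rho x v = 0) (v \in invariants rho).
Proof.
move=> lin; rewrite memvE; apply: (iffP subv_bigcapP) => [vU x|H i _].
  pose rl := GRing.isLinear.Build _ _ _ _ rho lin.
  pose rhoL : {linear g -> 'End(V)} := HB.pack rho rl.
  rewrite (coord_vbasis (memvf x)) -[rho]/(rhoL : _ -> _) linear_sum sum_lfunE.
  rewrite big1 // => i _; rewrite linearZ /= scale_lfunE.
  by have := vU i isT; rewrite -memvE memv_ker => /eqP ->; rewrite scaler0.
by rewrite -memvE memv_ker H.
Qed.

End Representations.

(* [rho] extended to the sum with u(1) by letting the generator act by [I]. *)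
Definition extend_u1 (R : fieldType) (g : lieAlgType R) (V : vectType R)
    (rho : g -> 'End(V)) (I : 'End(V)) (x : g * u1 R) : 'End(V) :=
  rho x.1 + u1_coef x.2 *: I.

Local Open Scope complex_scope.

(* The map [phi] is an isomorphism of real algebras from R[i] onto the
   centralizer of [rho]. *)
Definition is_complex_type (R : realType) (g : lieAlgType R) (V : vectType R)
    (rho : g -> 'End(V)) : Prop :=
  exists phi : R[i] -> 'End(V),
    [/\ forall z w, phi (z + w) = phi z + phi w,
        forall (a : R) z, phi (a%:C * z) = a *: phi z,
        phi 1 = \1%VF /\ (forall z w, phi (z * w) = (phi z \o phi w)%VF),
        injective phi
      & forall f, centralizes rho f <-> exists z, f = phi z].

Local Close Scope complex_scope.

Section SRepresentations.
Variable R : realType.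

Record is_euclidean (V : vectType R) (B : V -> V -> R) : Prop := IsEuclidean {
  euclidean_linear : forall w, scalar (B^~ w);
  euclidean_sym : forall v w, B v w = B w v;
  euclidean_pos : forall v, v != 0 -> 0 < B v v
}.

Definition is_invariant_form (g : lieAlgType R) (V : vectType R)
    (act : g -> V -> V) (B : V -> V -> R) : Prop :=
  forall x v w, B (act x v) w + B v (act x w) = 0.

Definition is_ad_invariant_euclidean (g : lieAlgType R) (B : g -> g -> R) :
    Prop :=
  is_euclidean B /\ is_invariant_form (@lie R g) B.

Definition B_u1 (x y : u1 R) : R := u1_coef x * u1_coef y.

Definition prod_form (V W : vectType R) (B : V -> V -> R) (C : W -> W -> R)
    (x y : V * W) : R :=
  B x.1 y.1 + C x.2 y.2.

Section Definitions.
Variables (k : lieAlgType R) (V : vectType R).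
Variables (Bk : k -> k -> R) (rho : k -> 'End(V)) (BV : V -> V -> R).

Record is_s_bracket (br : k * V -> k * V -> k * V) : Prop := IsSBracket {
  s_bracket_linear : forall y, linear (br^~ y);
  s_bracket_skew : forall x y, br x y = - br y x;
  s_bracket_kk : forall a b, br (a, 0) (b, 0) = (lie a b, 0);
  s_bracket_kV : forall a v, br (a, 0) (0, v) = (0, rho a v);
  s_bracket_VV : forall v w, (br (0, v) (0, w)).2 = 0;
  s_bracket_form : forall a v w,
    Bk a (br (0, v) (0, w)).1 = BV (rho a v) w
}.

End Definitions.

Definition satisfies_jacobi (T : vectType R) (br : T -> T -> T) : Prop :=
  forall x y z, br x (br y z) + br y (br z x) + br z (br x y) = 0.

(* The invariant product on [V] is unique up to a positive factor, the bracket
   it determines exists and is unique, and the Jacobi identity does not depend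
   on the factor. *)
Definition is_s_representation (k : lieAlgType R) (V : vectType R)
    (Bk : k -> k -> R) (rho : k -> 'End(V)) : Prop :=
  [/\ is_ad_invariant_euclidean Bk, is_rep rho, is_irreducible rho &
      exists (BV : V -> V -> R) (br : k * V -> k * V -> k * V),
        [/\ is_euclidean BV, is_invariant_form (fun x => rho x) BV,
            is_s_bracket Bk rho BV br & satisfies_jacobi br]].

End SRepresentations.

Section Multilinear.
Variables (R : fieldType) (k : nat) (V : vectType R).

Definition upd (v : {ffun 'I_k -> V}) (i : 'I_k) (x : V) : {ffun 'I_k -> V} :=
  [ffun j => if j == i then x else v j].

Definition is_multilinear (W : lmodType R) (f : {ffun 'I_k -> V} -> W) : Prop :=
  forall (v : {ffun 'I_k -> V}) (i : 'I_k), linear (fun x => f (upd v i x)).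

Definition is_alternating (W : lmodType R) (f : {ffun 'I_k -> V} -> W) : Prop :=
  forall (v : {ffun 'I_k -> V}) (i j : 'I_k), i != j -> v i = v j -> f v = 0.

Local Notation n := (\dim {:V}).
Local Notation e := (vbasis {:V}).

Definition basis_tuple (s : {ffun 'I_k -> 'I_n}) : {ffun 'I_k -> V} :=
  [ffun i => e`_(s i)].

(* The exterior power is realised as the space of antisymmetric tensors, given
   by their coordinates; [wedge v] has coordinates the minors
   det (coord (s i) (v j)). See [ext_power_universal]. *)
Definition wedge_tensor (v : {ffun 'I_k -> V}) :
    {ffun {ffun 'I_k -> 'I_n} -> R^o} :=
  [ffun s : {ffun 'I_k -> 'I_n} =>
     \det (\matrix_(i < k, j < k) coord e (s i) (v j)) : R^o].

Definition ext_vspace : {vspace {ffun {ffun 'I_k -> 'I_n} -> R^o}} :=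
  <<[seq wedge_tensor (basis_tuple s) | s : {ffun 'I_k -> 'I_n}]>>%VS.

Definition ext_power : vectType R := subvs_of ext_vspace.

Definition wedge (v : {ffun 'I_k -> V}) : ext_power :=
  vsproj ext_vspace (wedge_tensor v).

Definition ext_lift (W : lmodType R) (f : {ffun 'I_k -> V} -> W)
    (w : ext_power) : W :=
  (k`!%:R)^-1 *: \sum_(s : {ffun 'I_k -> 'I_n}) vsval w s *: f (basis_tuple s).

(* The derivation [v1 /\ ... /\ vk |-> \sum_i v1 /\ ... /\ X vi /\ ... /\ vk]. *)
Definition ext_der (X : 'End(V)) : 'End(ext_power) :=
  linfun (ext_lift (fun v => \sum_(i < k) wedge (upd v i (X (v i))))).

End Multilinear.

Section MultilinearTheory.
Variables (R : numFieldType) (k : nat) (V : vectType R).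
Implicit Types (W : lmodType R) (v : {ffun 'I_k -> V}).

Local Notation n := (\dim {:V}).
Local Notation e := (vbasis {:V}).

Lemma upd_id v i : upd v i (v i) = v.
Proof. by apply/ffunP => j; rewrite ffunE; case: eqP => // ->. Qed.

Lemma upd_upd v i x y : upd (upd v i x) i y = upd v i y.
Proof. by apply/ffunP => j; rewrite !ffunE; case: eqP. Qed.

Lemma updC v i j x y : i != j ->
  upd (upd v i x) j y = upd (upd v j y) i x.
Proof.
move=> ij; apply/ffunP => l; rewrite !ffunE.
by case: (l =P j) => // ->; rewrite eq_sym (negPf ij).
Qed.

Lemma upd_same v i x : upd v i x i = x.
Proof. by rewrite ffunE eqxx. Qed.

Lemma upd_neq v i j x : j != i -> upd v i x j = v j.
Proof. by rewrite ffunE => /negPf ->. Qed.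

Section Maps.
Variables (W : lmodType R) (f : {ffun 'I_k -> V} -> W).
Hypothesis f_lin : is_multilinear f.

Lemma multilinear_sum v i (I : Type) (r : seq I) (c : I -> R) (x : I -> V) :
  f (upd v i (\sum_(j <- r) c j *: x j)) =
  \sum_(j <- r) c j *: f (upd v i (x j)).
Proof.
pose rl := GRing.isLinear.Build _ _ _ _ (fun x => f (upd v i x)) (f_lin v i).
pose L : {linear V -> W} := HB.pack (fun x => f (upd v i x)) rl.
rewrite -[LHS]/(L _) linear_sum; apply: eq_bigr => j _.
by rewrite linearZ.
Qed.

Lemma multilinear_ind (P : W -> Prop) :
    P 0 -> (forall a x y, P x -> P y -> P (a *: x + y)) ->
    (forall s, P (f (basis_tuple s))) ->
  forall v, P (f v).
Proof.
move=> P0 PD Pe v.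
suff main m : forall v, (forall i : 'I_k, (m <= i)%N ->
    exists j : 'I_n, v i = e`_j) -> P (f v).
  by apply: (main k) => i; rewrite leqNgt ltn_ord.
elim: m => [|m IHm] {}v Hv.
  have /fin_all_exists [s Hs] : forall i, exists j : 'I_n, v i = e`_j.
    by move=> i; apply: Hv.
  suff -> : v = basis_tuple [ffun i => s i] by [].
  by apply/ffunP => i; rewrite !ffunE.
have [mk|km] := ltnP m k; last first.
  by apply: IHm => i mi; have := leq_trans (ltn_ord i) km; rewrite ltnNge mi.
pose i := Ordinal mk.
rewrite -(upd_id v i) (coord_vbasis (memvf (v i))) multilinear_sum.
elim/big_rec: _ => // j w _ Pw; apply: PD => //; apply: IHm => l ml.
rewrite ffunE; case: eqP => [_|/eqP li]; first by exists j.
by apply: Hv; rewrite ltn_neqAle ml andbT eq_sym.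
Qed.

Hypothesis f_alt : is_alternating f.

Lemma alternating_swap v i j x y : i != j ->
  f (upd (upd v i x) j y) = - f (upd (upd v i y) j x).
Proof.
move=> ij; pose g x y := f (upd (upd v i x) j y).
have gDr a b c : g a (b + c) = g a b + g a c.
  by rewrite /g; have := f_lin (upd v i a) j 1 b c; rewrite !scale1r.
have gDl a b c : g (a + b) c = g a c + g b c.
  rewrite /g !(updC _ _ _ ij).
  by have := f_lin (upd v j c) i 1 a b; rewrite !scale1r.
have g0 a : g a a = 0.
  by apply: (f_alt ij); rewrite upd_same upd_neq // upd_same.
have := g0 (x + y); rewrite gDl !gDr !g0 add0r addr0.
by move/eqP; rewrite addr_eq0 => /eqP.
Qed.

Lemma alternating_perm v (s : 'S_k) :
  f [ffun i => v (s i)] = (-1) ^+ s *: f v.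
Proof.
have [ts -> tsP] := prod_tpermP s.
elim: ts tsP v => [_|[i j] ts IH] /= => [|/andP[ij tsP]] v.
  rewrite big_nil odd_perm1 expr0 scale1r; congr (f _).
  by apply/ffunP => l; rewrite ffunE perm1.
rewrite big_cons /= odd_mul_tperm ij /= signrN scaleNr.
rewrite -IH //; set t := (\prod_(_ <- _) _)%g.
set w := [ffun l => v (t l)].
rewrite -[in RHS](upd_id w i) -[in RHS](upd_id (upd w i (w i)) j).
rewrite [upd w i (w i) j]upd_neq 1?eq_sym // -alternating_swap //.
congr (f _); apply/ffunP => l; rewrite !ffunE permM.
case: tpermP => [->|->|/eqP/negPf li /eqP/negPf lj].
- by rewrite (negPf ij) eqxx.
- by rewrite eqxx.
- by rewrite li lj.
Qed.

End Maps.

Lemma wedge_tensor_multilinear : is_multilinear (@wedge_tensor R k V).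
Proof.
move=> v i a x y; apply/ffunP => s; rewrite !ffunE /=.
pose M z := (\matrix_(p < k, q < k) coord e (s p) (upd v i z q))^T.
suff : \det (M (a *: x + y)) = a * \det (M x) + 1 * \det (M y).
  by rewrite !det_tr mul1r.
apply: (@determinant_multilinear _ _ _ _ _ i).
- by apply/rowP => l; rewrite !mxE !upd_same linearP mul1r.
- by apply/matrixP => p q; rewrite !mxE !upd_neq // eq_sym; exact: neq_lift.
- by apply/matrixP => p q; rewrite !mxE !upd_neq // eq_sym; exact: neq_lift.
Qed.

Lemma wedge_tensor_alternating : is_alternating (@wedge_tensor R k V).
Proof.
move=> v i j ij vij; apply/ffunP => s; rewrite !ffunE -det_tr.
by apply: (determinant_alternate ij) => l; rewrite !mxE vij.
Qed.

Lemma wedge_tensor_in v : wedge_tensor v \in ext_vspace k V.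
Proof.
apply: (multilinear_ind wedge_tensor_multilinear
  (P := fun w => w \in ext_vspace k V)) => [|a x y|s].
- exact: mem0v.
- by move=> xU yU; rewrite memvD // memvZ.
- by apply: memv_span; apply: map_f; rewrite mem_enum.
Qed.

Lemma vsval_wedge v : vsval (wedge v) = wedge_tensor v.
Proof. by rewrite /wedge vsprojK ?wedge_tensor_in. Qed.

Lemma wedge_multilinear : is_multilinear (@wedge R k V).
Proof.
by move=> v i a x y; rewrite /wedge (wedge_tensor_multilinear v i a x y) linearP.
Qed.

Lemma wedge_alternating : is_alternating (@wedge R k V).
Proof.
by move=> v i j ij vij; rewrite /wedge (wedge_tensor_alternating ij vij) linear0.
Qed.

Lemma ext_lift_linear W (f : {ffun 'I_k -> V} -> W) : linear (ext_lift f).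
Proof.
move=> a x y; rewrite /ext_lift scalerA mulrC -scalerA -scalerDr; congr (_ *: _).
rewrite scaler_sumr -big_split; apply: eq_bigr => s _ /=.
by rewrite !ffunE scalerDl scalerA.
Qed.

HB.instance Definition _ W (f : {ffun 'I_k -> V} -> W) :=
  GRing.isLinear.Build R (ext_power k V) W _ (ext_lift f) (ext_lift_linear f).

Lemma ext_lift_wedge W (f : {ffun 'I_k -> V} -> W) :
    is_multilinear f -> is_alternating f ->
  forall v, ext_lift f (wedge v) = f v.
Proof.
move=> f_lin f_alt v; apply/eqP; rewrite -subr_eq0; apply/eqP.
pose d v := ext_lift f (wedge v) - f v.
have d_lin : is_multilinear d.
  move=> {}v i a x y; rewrite /d wedge_multilinear linearP f_lin.
  by rewrite scalerBr opprD addrACA.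
apply: (@multilinear_ind _ d d_lin (fun w => w = 0)) => // [a x y -> ->|t].
  by rewrite scaler0 addr0.
apply/eqP; rewrite subr_eq0 /ext_lift vsval_wedge; apply/eqP.
under eq_bigr => s _.
  rewrite ffunE /determinant scaler_suml.
  under eq_bigr => p _.
    rewrite (_ : \prod_i _ = (s == [ffun i => t (p i)])%:R); last first.
      under eq_bigr => i _ do
        rewrite mxE ffunE (coord_free _ _ (basis_free (vbasisP _))).
      case: eqP => [->|ne]; first by rewrite big1 // => i _; rewrite ffunE eqxx.
      have [i si] : exists i, s i != t (p i).
        apply/existsP; rewrite -negb_forall; apply/negP => /forallP H.
        by apply: ne; apply/ffunP => i; rewrite ffunE; apply/eqP.
      by rewrite (bigD1 i) //= eq_sym (negPf si) mul0r.
    over.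
  over.
rewrite exchange_big /=.
under eq_bigr => p _.
  rewrite (bigD1 [ffun i => t (p i)]) //= eqxx mulr1 big1 ?addr0; last first.
    by move=> s /negPf ->; rewrite mulr0 scale0r.
  rewrite (_ : basis_tuple _ = [ffun i => basis_tuple t (p i)]); last first.
    by apply/ffunP => i; rewrite !ffunE.
  rewrite (alternating_perm f_lin f_alt) scalerA -signr_addb addbb scale1r.
  over.
rewrite sumr_const card_Sn -[X in _ *: X]scaler_nat scalerA mulVf ?scale1r //.
by rewrite pnatr_eq0 -lt0n fact_gt0.
Qed.

Lemma ext_power_eq W (f g : {linear ext_power k V -> W}) :
  (forall v, f (wedge v) = g (wedge v)) -> f =1 g.
Proof.
move=> fg w; rewrite -[w]vsvalK.
rewrite (coord_span (X := in_tuple _) (subvsP w)) !linear_sum.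
apply: eq_bigr => i _; rewrite !linearZ; congr (_ *: _).
have /mapP[s _ ->] := mem_nth 0 (ltn_ord i); exact: fg.
Qed.

Theorem ext_power_universal W (f : {ffun 'I_k -> V} -> W) :
    is_multilinear f -> is_alternating f ->
  exists2 g : {linear ext_power k V -> W}, (forall v, g (wedge v) = f v) &
    forall g' : {linear ext_power k V -> W},
      (forall v, g' (wedge v) = f v) -> g' =1 g.
Proof.
move=> f_lin f_alt; exists (ext_lift f) => [|g' g'f].
  exact: ext_lift_wedge.
by apply: ext_power_eq => v; rewrite g'f /= ext_lift_wedge.
Qed.

Lemma ext_der_wedge (X : 'End(V)) v :
  ext_der k X (wedge v) = \sum_(i < k) wedge (upd v i (X (v i))).
Proof.
rewrite /ext_der lfunE /= ext_lift_wedge //= => [u i a x y|u i j ij uij].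
  rewrite scaler_sumr -big_split; apply: eq_bigr => l _ /=.
  have [->|il] := eqVneq l i.
    by rewrite !upd_upd !upd_same linearP wedge_multilinear.
  by rewrite !upd_neq // !(updC _ _ _ (negbT _ : i != l)) 1?eq_sym ?(negPf il)
       // wedge_multilinear.
have ji : j != i by rewrite eq_sym.
rewrite (bigD1 i) //= (bigD1 j) //= big1 => [|l /andP[li lj]]; last first.
  by apply: (wedge_alternating ij); rewrite !upd_neq // eq_sym.
rewrite addr0 -uij -{1}(upd_id u j) -uij -[X in _ + wedge (upd X _ _)](upd_id u i).
rewrite (updC _ _ _ ji).
rewrite (alternating_swap wedge_multilinear wedge_alternating) //.
by rewrite addrC subrr.
Qed.

End MultilinearTheory.

Definition ext_rep (R : fieldType) (g : lieAlgType R) (V : vectType R) (k : nat)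
    (rho : g -> 'End(V)) (x : g) : 'End(ext_power k V) :=
  ext_der k (rho x).

(* Main.v *)
(* An invariant Euclidean product on [m]: let [A i] be the matrices of an
   orthonormal basis of [h], and choose a basis of [m] minimising
   [sum_i |A i|^2]; by irreducibility the minimisation cannot degenerate. At a
   minimum [sum_i A i (A i)^T = sum_i (A i)^T A i], which together with the
   [ad]-invariance of the product on [h] forces every [A i + (A i)^T] to commute
   with [rho], hence to be a scalar, and this scalar is [0] as [h] is perfect.

   For fixed [r], the Jacobi identity on [h + u(1) + m] reduces to the vanishing
   of the 4-form [T_h + r^-1 T_I], where [T_h] is the sum of the squares
   [w_i /\ w_i], [w_i (v, w) = <A i v, w>], and [T_I] is the square of
   [w (v, w) = <I v, w>]. Both are invariant under [h + u(1)], so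
   [T_h = c T_I] by the dimension hypothesis. Contracting twice with [w] sends
   [T_I] to [n^2 - 2 n > 0] with [n = dim m] and [T_h] to [2 tr (sum_i A i^2) < 0].
   Hence [c < 0], and [r = - 1/c] is the only solution; the trace does not depend
   on the chosen invariant product on [m]. *)

Require Import Defs.
From HB Require Import structures.
From mathcomp Require Import all_boot all_order all_fingroup all_algebra.
From mathcomp Require Import complex.
From mathcomp Require Import reals.
From mathcomp Require Import boolp classical_sets topology normedtype derive.
From mathcomp Require Import ring lra.

Import Order.TTheory GRing.Theory Num.Theory.
Local Open Scope ring_scope.

Set Implicit Arguments.
Unset Strict Implicit.
Unset Printing Implicit Defensive.

(** * Existence of an invariant Euclidean product: matrix form *)

(** The squared Frobenius norm, as a trace so that conjugates can be expanded by cyclicity. *)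
Definition sqnorm (R : pzRingType) m n (X : 'M[R]_(m, n)) : R :=
  \tr (X *m X^T).

Lemma sqnormE (R : comNzRingType) m n (X : 'M[R]_(m, n)) :
  sqnorm X = \sum_i \sum_j X i j ^+ 2.
Proof.
by apply: eq_bigr => i _; rewrite mxE; apply: eq_bigr => j _; rewrite mxE expr2.
Qed.

Lemma sqnorm_ge0 (R : realDomainType) m n (X : 'M[R]_(m, n)) : 0 <= sqnorm X.
Proof.
by rewrite sqnormE; apply: sumr_ge0 => i _; apply: sumr_ge0 => j _; apply: sqr_ge0.
Qed.

Lemma sqnorm_eq0 (R : realDomainType) m n (X : 'M[R]_(m, n)) :
  (sqnorm X == 0) = (X == 0).
Proof.
apply/eqP/eqP => [|->]; last by rewrite /sqnorm mul0mx mxtrace0.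
rewrite sqnormE => /psumr_eq0P X0; apply/matrixP => i j; rewrite mxE.
have /psumr_eq0P := X0 (fun i _ => sumr_ge0 _ (fun j _ => sqr_ge0 _)) i isT.
move=> /(_ (fun j _ => sqr_ge0 _) j isT) /eqP.
by rewrite sqrf_eq0 => /eqP.
Qed.

Lemma sqnormZ (R : comNzRingType) m n (a : R) (X : 'M[R]_(m, n)) :
  sqnorm (a *: X) = a ^+ 2 * sqnorm X.
Proof.
by rewrite /sqnorm linearZ /= -scalemxAl -scalemxAr scalerA mxtraceZ expr2.
Qed.

Lemma sqr_entry_le (R : realDomainType) m n (X : 'M[R]_(m, n)) i j :
  X i j ^+ 2 <= sqnorm X.
Proof.
rewrite sqnormE (bigD1 i) //= (bigD1 j) //= -addrA lerDl addr_ge0 //.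
  by apply: sumr_ge0 => ? _; apply: sqr_ge0.
by apply: sumr_ge0 => ? _; apply: sumr_ge0 => ? _; apply: sqr_ge0.
Qed.

(** * Compactness and the minimising conjugate *)

Section Minimum.
Import numFieldNormedType.Exports.
Local Open Scope classical_set_scope.

Lemma sqnorm_continuous (T : topologicalType) (R : realType) m n
    (F : T -> 'M[R]_(m, n)) :
  (forall i j, continuous (fun x => F x i j)) ->
  continuous (fun x => sqnorm (F x)).
Proof.
move=> Fc; under eq_fun do rewrite sqnormE.
move=> x.
apply: cvg_big => [|i _]; first exact: add_continuous.
apply: cvg_big => [|j _]; first exact: add_continuous.
under eq_fun do rewrite expr2.
by apply: cvgM; apply: Fc.
Qed.

Lemma mulmx_continuous (T : topologicalType) (R : realType) m n p
    (F : T -> 'M[R]_(m, n)) (G : T -> 'M[R]_(n, p)) :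
  (forall i j, continuous (fun x => F x i j)) ->
  (forall i j, continuous (fun x => G x i j)) ->
  forall i j, continuous (fun x => (F x *m G x) i j).
Proof.
move=> Fc Gc i j; under eq_fun do rewrite mxE.
move=> x; apply: cvg_big => [|k _]; first exact: add_continuous.
by apply: cvgM; [apply: Fc | apply: Gc].
Qed.

Lemma submx_continuous (T : topologicalType) (R : realType) m n
    (F G : T -> 'M[R]_(m, n)) :
  (forall i j, continuous (fun x => F x i j)) ->
  (forall i j, continuous (fun x => G x i j)) ->
  forall i j, continuous (fun x => (F x - G x) i j).
Proof.
move=> Fc Gc i j; under eq_fun do rewrite mxE [X in _ + X]mxE.
by move=> x; apply: cvgB; [apply: Fc | apply: Gc].
Qed.

Lemma sum_sqnorm_continuous (T : topologicalType) (R : realType) d m n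
    (F : 'I_d -> T -> 'M[R]_(m, n)) :
  (forall k i j, continuous (fun x => F k x i j)) ->
  continuous (fun x => \sum_k sqnorm (F k x)).
Proof.
move=> Fc x; apply: cvg_big => [|i _]; first exact: add_continuous.
exact: sqnorm_continuous.
Qed.

(* [X i] is the conjugate [g^-1 A i g]. Keeping [X] as an unknown and allowing
   singular [g] makes the constraints polynomial, so that, after normalising
   [|g| = 1], the minimisation takes place on a compact set. *)
Lemma exists_minimal_conjugate (R : realType) n d (A : 'I_d -> 'M[R]_n) :
    (0 < n)%N ->
  exists (g : 'M[R]_n) (X : 'I_d -> 'M[R]_n),
    [/\ g != 0, forall i, A i *m g = g *m X i &
      forall (g' : 'M[R]_n) (X' : 'I_d -> 'M[R]_n),
        g' != 0 -> (forall i, A i *m g' = g' *m X' i) ->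
        \sum_i sqnorm (X i) <= \sum_i sqnorm (X' i)].
Proof.
move=> n_gt0.
(* Packs [g] (index [None]) and the [X i] (index [Some i]) into one row vector, the setting of
   [EVT_min_rV]. *)
pose J : finType := (option 'I_d * ('I_n * 'I_n))%type.
pose Y (o : option 'I_d) (x : 'rV[R]_#|J|) : 'M[R]_n :=
  \matrix_(a, b) x 0 (enum_rank (o, (a, b))).
have Yc o i j : continuous (fun x => Y o x i j).
  under eq_fun do rewrite mxE.
  exact: coord_continuous.
pose x_of (g : 'M[R]_n) (X : 'I_d -> 'M[R]_n) : 'rV[R]_#|J| :=
  \row_k (let: (o, (a, b)) := enum_val k in
          if o is Some i then X i a b else g a b).
have YN g X : Y None (x_of g X) = g.
  by apply/matrixP => a b; rewrite !mxE enum_rankK.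
have YS g X i : Y (Some i) (x_of g X) = X i.
  by apply/matrixP => a b; rewrite !mxE enum_rankK.
(* [f1 = 0] encodes the equations [A i *m g = g *m X i], [f2 = 1] the normalisation of [g], and [f3]
   is the quantity to minimise. *)
pose f1 x := \sum_(i < d) sqnorm (A i *m Y None x - Y None x *m Y (Some i) x).
pose f2 x := sqnorm (Y None x).
pose f3 x := \sum_(i < d) sqnorm (Y (Some i) x).
have f1c : continuous f1.
  apply: sum_sqnorm_continuous => i; apply: submx_continuous.
    by apply: mulmx_continuous => a b; [exact: cst_continuous | exact: Yc].
  by apply: mulmx_continuous => a b; exact: Yc.
have f2c : continuous f2 by apply: sqnorm_continuous.
have f3c : continuous f3 by apply: sum_sqnorm_continuous.
pose C := \sum_i sqnorm (A i).
(* The bound on [f3] makes [K] bounded; it admits the point with [g] a multiple of the identity and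
   [X = A], where [f3 = C], since [1 <= n]. *)
pose K := (f1 @^-1` [set x | x = 0]) `&` (f2 @^-1` [set x | x = 1]) `&`
  (f3 @^-1` [set x | x <= C * n%:R]).
have K_closed : closed K.
  apply: closedI; first apply: closedI.
  - exact: (continuous_closedP f1).1 f1c _ (@closed_eq _ _).
  - exact: (continuous_closedP f2).1 f2c _ (@closed_eq _ _).
  - exact: (continuous_closedP f3).1 f3c _ (@closed_le _ _).
have C_ge0 : 0 <= C by apply: sumr_ge0 => i _; apply: sqnorm_ge0.
have K_bounded : bounded_set K.
  exists (C * n%:R + 1); split; first exact: num_real.
  move=> M /ltW leM x [[_ x2] x3]; apply: le_trans leM.
  have B_ge1 : 1 <= C * n%:R + 1 by rewrite lerDr mulr_ge0.
  rewrite /Num.norm /= mx_normrE; apply/bigmax_leP; split => [|] /=.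
    exact: le_trans B_ge1.
  case=> [u k] _ /=.
  rewrite (ord1 u) -(enum_valK k); case: (enum_val k) => o [a b].
  have -> : x 0 (enum_rank (o, (a, b))) = Y o x a b by rewrite mxE.
  have le1 : `|Y o x a b| ^+ 2 <= C * n%:R + 1.
    rewrite real_normK ?num_real //; apply: le_trans (sqr_entry_le _ _ _) _.
    case: o => [i|].
      apply: (@le_trans _ _ (f3 x)); last first.
        by apply: le_trans x3 _; rewrite lerDl.
      by rewrite /f3 (bigD1 i) //= lerDl sumr_ge0 // => ? _; apply: sqnorm_ge0.
    by rewrite -/(f2 x) x2 lerDr mulr_ge0.
  (* An entry of absolute value t above [C * n + 1 >= 1] would satisfy [t < t^2], against
     [t^2 <= C * n + 1]. *)
  rewrite leNgt; apply/negP => lt; move: le1; apply/negP; rewrite -ltNge.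
  have t_gt1 : 1 < `|Y o x a b| by apply: le_lt_trans lt.
  by apply: lt_trans lt _; rewrite expr2 ltr_pMl // (lt_trans ltr01).
pose c : R := Num.sqrt (n%:R^-1).
have c2 : c ^+ 2 = n%:R^-1 by rewrite sqr_sqrtr // invr_ge0.
have sq1 : sqnorm (1%:M : 'M[R]_n) = n%:R.
  by rewrite /sqnorm trmx1 mulmx1 mxtrace1.
have n_neq0 : n%:R != 0 :> R by rewrite pnatr_eq0 -lt0n.
have n_ge1 : 1 <= n%:R :> R by rewrite ler1n.
have K_ne : K !=set0.
  exists (x_of (c *: 1%:M) A); split; first split.
  - rewrite /= /f1 big1 // => i _; rewrite YN YS -scalemxAr mulmx1.
    rewrite -scalemxAl mul1mx subrr.
    by apply/eqP; rewrite sqnorm_eq0.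
  - by rewrite /= /f2 YN sqnormZ sq1 c2 mulVf.
  - rewrite /= /f3; under eq_bigr do rewrite YS.
    by rewrite -/C; nra.
have K_compact := bounded_closed_compact K_bounded K_closed.
have f3w : {within K, continuous f3} by apply: continuous_subspaceT.
have [x /set_mem [[x1 x2] x3] xmin] := EVT_min_rV K_ne K_compact f3w.
exists (Y None x), (fun i => Y (Some i) x); split.
- by rewrite -sqnorm_eq0 -/(f2 x) x2 oner_eq0.
- move=> i; apply/eqP; rewrite -subr_eq0 -sqnorm_eq0; apply/eqP.
  by apply: (psumr_eq0P _ x1) => // j _; apply: sqnorm_ge0.
move=> g X g0 gX; rewrite -/(f3 x).
have sg_gt0 : 0 < sqnorm g by rewrite lt_def sqnorm_eq0 g0 sqnorm_ge0.
(* The equations are homogeneous in [g], so [g] can be normalised without changing [X]. *)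
pose s := Num.sqrt (sqnorm g)^-1.
have s2 : s ^+ 2 = (sqnorm g)^-1.
  by rewrite sqr_sqrtr // invr_ge0 sqnorm_ge0.
have f3E : f3 (x_of (s *: g) X) = \sum_i sqnorm (X i).
  by apply: eq_bigr => i _; rewrite YS.
(* A competitor beyond the bound defining [K] exceeds the minimum anyway. *)
have [le|gt] := leP (f3 (x_of (s *: g) X)) (C * n%:R); last first.
  by rewrite -f3E; apply: le_trans (ltW gt).
rewrite -f3E; apply: xmin; apply/mem_set; split => //; split.
- rewrite /= /f1 big1 // => i _; rewrite YN YS -scalemxAr -scalemxAl gX subrr.
  by apply/eqP; rewrite sqnorm_eq0.
- by rewrite /= /f2 YN sqnormZ s2 mulVf // gt_eqF.
Qed.

End Minimum.

(** * Minimal conjugates: the moment condition and skew-symmetry *)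

Definition mxcomm (R : pzRingType) n (X Y : 'M[R]_n) := X *m Y - Y *m X.

Lemma sqnormD (R : comNzRingType) m n (X Y : 'M[R]_(m, n)) :
  sqnorm (X + Y) = sqnorm X + \tr (X *m Y^T) *+ 2 + sqnorm Y.
Proof.
rewrite /sqnorm linearD /= mulmxDl !mulmxDr !mxtraceD.
by rewrite -[\tr (Y *m X^T)]mxtrace_tr trmx_mul trmxK mulr2n !addrA.
Qed.

Lemma sqnormN (R : pzRingType) m n (X : 'M[R]_(m, n)) :
  sqnorm (- X) = sqnorm X.
Proof. by rewrite /sqnorm linearN /= mulNmx mulmxN opprK. Qed.

(** Isolates [A *m A^T] and [A^T *m A]: once summed over a family for which these have equal sums,
    the first two terms are insensitive to replacing [X] by its transpose. *)
Lemma sqnorm_mxcomm (R : comNzRingType) n (X A : 'M[R]_n) :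
  sqnorm (mxcomm X A) =
  \tr (X^T *m X *m (A *m A^T)) + \tr (X *m X^T *m (A^T *m A))
  - \tr (X *m A *m X^T *m A^T) *+ 2.
Proof.
rewrite /mxcomm sqnormD sqnormN [in \tr _]linearN /= mulmxN linearN /=.
rewrite /sqnorm !trmx_mul.
have -> : \tr (X *m A *m (A^T *m X^T)) = \tr (X^T *m X *m (A *m A^T)).
  by rewrite !mulmxA mxtrace_mulC !mulmxA.
have -> : \tr (A *m X *m (X^T *m A^T)) = \tr (X *m X^T *m (A^T *m A)).
  by rewrite [RHS]mxtrace_mulC !mulmxA [LHS]mxtrace_mulC !mulmxA.
by rewrite !mulmxA mulNrn addrAC.
Qed.

(** Polarisation: unit vectors give the diagonal entries, sums of two of them twice the others. *)
Lemma symmx_eq0 (R : numDomainType) n (M : 'M[R]_n) :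
  M^T = M -> (forall v : 'rV_n, v *m M *m v^T = 0) -> M = 0.
Proof.
move=> Msym Mv; apply/matrixP => i j; rewrite mxE.
have E a b : (delta_mx 0 a : 'rV_n) *m M *m (delta_mx 0 b)^T = (M a b)%:M.
  rewrite -rowE trmx_delta -colE; apply/matrixP => x y.
  by rewrite !mxE !ord1 eqxx mulr1n.
have inj (a : R) : (a%:M : 'M_1) = 0 -> a = 0.
  by move/matrixP/(_ 0 0); rewrite !mxE eqxx mulr1n.
have M0 a : M a a = 0 by apply: inj; rewrite -E.
have := Mv (delta_mx 0 i + delta_mx 0 j).
rewrite linearD /= mulmxDl mulmxDl !mulmxDr !E !M0 raddf0 add0r addr0.
rewrite -{2}Msym [M^T j i]mxE -raddfD => /inj/eqP.
by rewrite -mulr2n mulrn_eq0 => /eqP.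
Qed.

(** First-order condition at [u = 0]. The test value [u = - D / K], with [K] larger than [|D|] and
    [|E|], is above [-1] and gives [- D^2 / K^2 * (K - E)], negative unless [D = 0]. *)
Lemma quadratic_ge0_lin_eq0 (R : realFieldType) (D E : R) :
  (forall u : R, -1 < u -> 0 <= u * (D + u * E)) -> D = 0.
Proof.
move=> H; apply/eqP/negPn/negP => D0.
pose K := `|D| + `|E| + 1.
have D_gt0 : 0 < `|D| by rewrite normr_gt0.
have K_gt0 : 0 < K by have := normr_ge0 E; rewrite /K; lra.
have := H (- D / K).
have -> : (- D / K) * (D + (- D / K) * E) = - (D ^+ 2 / K ^+ 2 * (K - E)).
  by field; rewrite gt_eqF.
rewrite mulNr ltrN2 ltr_pdivrMr // mul1r.
have DK : D < K by have := (normr_ge0 E, ler_norm D); rewrite /K => -[]; lra.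
move=> /(_ DK); rewrite oppr_ge0 leNgt => /negP; apply.
rewrite mulr_gt0 // ?subr_gt0.
  by apply: divr_gt0; [rewrite lt_def sqrf_eq0 D0 sqr_ge0 | exact: exprn_gt0].
have := ler_norm E; rewrite /K; lra.
Qed.

(* Conjugate by [1 + (r - 1) p], with [p] the projection onto a line and
   [r = sqrt (1 + u)]: the variation of the norm is then a rational function
   of [u]. *)
Lemma minimal_moment (R : realType) n d (X : 'I_d -> 'M[R]_n) :
  (forall h : 'M[R]_n, h \in unitmx ->
     \sum_i sqnorm (X i) <= \sum_i sqnorm (invmx h *m X i *m h)) ->
  \sum_i X i *m (X i)^T = \sum_i (X i)^T *m X i.
Proof.
move=> Xmin; apply/eqP; rewrite -subr_eq0; apply/eqP.
apply: symmx_eq0 => [|v].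
  have symS (F : 'I_d -> 'M[R]_n) :
      (forall i, (F i)^T = F i) -> (\sum_i F i)^T = \sum_i F i.
    by move=> FT; rewrite linear_sum; apply: eq_bigr => i _; apply: FT.
  by rewrite linearB /= !symS // => i; rewrite trmx_mul trmxK.
have [->|v0] := eqVneq v 0; first by rewrite mul0mx mul0mx.
have q0 : sqnorm v != 0 by rewrite sqnorm_eq0.
have vv : v *m v^T = (sqnorm v)%:M.
  apply/matrixP => i j.
  by rewrite /sqnorm !ord1 [in RHS]mxE /mxtrace big_ord1 mulr1n.
pose p : 'M_n := (sqnorm v)^-1 *: (v^T *m v).
have pp : p *m p = p.
  rewrite /p -scalemxAl -scalemxAr -mulmxA (mulmxA v) vv.
  by rewrite mul_scalar_mx -scalemxAr scalerK.
have pT : p^T = p by rewrite /p linearZ /= trmx_mul trmxK.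
(* The sums of the squared norms of [X i *m p], [p *m X i] and [p *m X i *m p]. The value at [v] of
   the form to be killed is a nonzero multiple of [b - a]. *)
pose a := \tr (p *m \sum_i (X i)^T *m X i).
pose b := \tr (p *m \sum_i X i *m (X i)^T).
pose c := \tr (\sum_i p *m X i *m p *m (X i)^T).
suff ab : a - b = 0.
  set D := _ - _; suff : \tr (p *m D) = 0.
    rewrite /p -scalemxAl mxtraceZ mxtrace_mulC mulmxA mxtrace_mulC -mulmxA => /eqP.
    rewrite mulf_eq0 invr_eq0 (negPf q0) /= /mxtrace big_ord1 => /eqP w0.
    by apply/matrixP => i j; rewrite !ord1 w0 mxE.
  by rewrite /D mulmxBr linearB /= -opprB ab oppr0.
clearbody p.
apply: (@quadratic_ge0_lin_eq0 _ _ (a - c)) => u u_gt.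
have u1 : 0 < 1 + u by lra.
pose r : R := Num.sqrt (1 + u).
have r2 : r ^+ 2 = 1 + u by rewrite sqr_sqrtr // ltW.
have r_gt0 : 0 < r by rewrite sqrtr_gt0.
pose h : 'M_n := 1%:M + (r - 1) *: p.
pose k : 'M_n := 1%:M + (r^-1 - 1) *: p.
have mulp x y : (1%:M + x *: p) *m (1%:M + y *: p) =
    1%:M + (x + y + x * y) *: p.
  rewrite mulmxDl !mulmxDr !mulmx1 !mul1mx -scalemxAl -scalemxAr pp scalerA.
  by rewrite !scalerDl -!addrA; congr (_ + _); rewrite addrCA.
have kh : k *m h = 1%:M.
  rewrite mulp [X in X *: p](_ : _ = 0) ?scale0r ?addr0 //.
  by field; rewrite gt_eqF.
have [_ hU] := mulmx1_unit kh.
have hV : invmx h = k by rewrite -[k]mulmx1 -(mulmxV hU) mulmxA kh mul1mx.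
have hT : h^T = h by rewrite linearD linearZ /= trmx1 pT.
have kT : k^T = k by rewrite linearD linearZ /= trmx1 pT.
have hh : h *m h = 1%:M + u *: p.
  rewrite mulp; congr (_ + _ *: _).
  transitivity (r ^+ 2 - 1); first by ring.
  by rewrite r2 addrAC subrr add0r.
have kk : k *m k = 1%:M - (u / (1 + u)) *: p.
  rewrite mulp -scaleNr; congr (_ + _ *: _).
  transitivity ((r ^+ 2)^-1 - 1); first by field; rewrite gt_eqF.
  by rewrite r2; field; rewrite gt_eqF.
have E i : sqnorm (invmx h *m X i *m h) = sqnorm (X i)
    + u * \tr (p *m ((X i)^T *m X i))
    - u / (1 + u) * \tr (p *m (X i *m (X i)^T))
    - u * (u / (1 + u)) * \tr (p *m X i *m p *m (X i)^T).
  rewrite hV /sqnorm !trmx_mul hT kT.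
  transitivity (\tr (k *m k *m (X i *m (h *m h) *m (X i)^T))).
    by rewrite !mulmxA mxtrace_mulC !mulmxA.
  rewrite kk hh mulmxDr mulmx1 mulmxDl mulmxBl mul1mx -!scalemxAr -!scalemxAl.
  rewrite mulmxDr -!scalemxAr -!mulmxA linearB linearD linearZ /= linearZ /=.
  rewrite linearD linearZ /= (mxtrace_mulC (X i) (p *m _)) -!mulmxA.
  by ring.
have := Xmin h hU.
under [X in _ <= X]eq_bigr do rewrite E.
rewrite !big_split /= !sumrN -!mulr_sumr.
have -> : \sum_i \tr (p *m ((X i)^T *m X i)) = a by rewrite /a mulmx_sumr linear_sum.
have -> : \sum_i \tr (p *m (X i *m (X i)^T)) = b by rewrite /b mulmx_sumr linear_sum.
have -> : \sum_i \tr (p *m X i *m p *m (X i)^T) = c by rewrite /c linear_sum.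
rewrite -!addrA lerDl => H.
(* Multiplying by [1 + u] clears the denominators and leaves a quadratic in [u] with linear
   coefficient [a - b]. *)
have := mulr_ge0 (ltW u1) H.
rewrite (_ : (1 + u) * _ = u * (a + (- b + u * (a - c)))) //.
by field; rewrite gt_eqF.
Qed.

(* With [Y i := [X k, X i] = sum_j c k i j X j], skewness of [c] gives
   [<[(X k)^T, X i], Y i> = - |Y i|^2] after summing over [i], so that
   [sum_i |[(X k)^T, X i] + Y i|^2 = N - 2 N + N = 0]. *)
Lemma moment_comm_sym (R : realDomainType) n d (X : 'I_d -> 'M[R]_n)
    (c : 'I_d -> 'I_d -> 'I_d -> R) :
    (forall k i j, c k i j = - c k j i) ->
    (forall k i, mxcomm (X k) (X i) = \sum_j c k i j *: X j) ->
    \sum_i X i *m (X i)^T = \sum_i (X i)^T *m X i ->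
  forall k i, (X k + (X k)^T) *m X i = X i *m (X k + (X k)^T).
Proof.
move=> c_skew X_br X_moment k i.
pose Y i := mxcomm (X k) (X i).
pose Z i := mxcomm (X k)^T (X i).
have normZ : \sum_i sqnorm (Z i) = \sum_i sqnorm (Y i).
  (* With equal moments this expression takes the same value at [W] and at [W^T], so [Z] and [Y]
     have the same total norm. *)
  have normE W : \sum_i sqnorm (mxcomm W (X i)) =
      \tr (W^T *m W *m \sum_i X i *m (X i)^T)
      + \tr (W *m W^T *m \sum_i (X i)^T *m X i)
      - (\sum_i \tr (W *m X i *m W^T *m (X i)^T)) *+ 2.
    under eq_bigr do rewrite sqnorm_mxcomm.
    rewrite !big_split /= sumrN -sumrMnl !mulmx_sumr.
    by rewrite !(linear_sum (mxtrace : 'M[R]_n -> R)).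
  rewrite !normE X_moment trmxK; congr (_ - _ *+ 2); first by rewrite addrC.
  apply: eq_bigr => j _; rewrite -mxtrace_tr !trmx_mul !trmxK.
  by rewrite !mulmxA mxtrace_mulC !mulmxA mxtrace_mulC !mulmxA.
(* For the trace product, bracketing with [(X k)^T] is adjoint to bracketing with [X k]. *)
have crossE W V : \tr (mxcomm (X k)^T W *m V^T) = \tr (W *m (mxcomm (X k) V)^T).
  rewrite /mxcomm mulmxBl linearB /= [in RHS]linearB /= mulmxBr.
  rewrite [RHS]linearB /= !trmx_mul -!mulmxA; congr (_ - _).
  by rewrite mxtrace_mulC mulmxA.
have cross : \sum_i \tr (Z i *m (Y i)^T) = - \sum_i sqnorm (Y i).
  under eq_bigr => j _.
    rewrite crossE /Y (X_br k j) /mxcomm.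
    rewrite mulmx_sumr mulmx_suml -sumrB.
    under eq_bigr => l _ do
      rewrite -scalemxAr -scalemxAl -scalerBr -/(mxcomm (X k) (X l)) -/(Y l) c_skew.
    rewrite linear_sum mulmx_sumr linear_sum /=.
    under eq_bigr => l _ do rewrite linearZ /= -scalemxAr mxtraceZ mulNr.
    over.
  rewrite exchange_big -sumrN /=; apply: eq_bigr => l _.
  rewrite /sqnorm; set V := (Y l)^T; rewrite /Y X_br mulmx_suml linear_sum /=.
  rewrite -sumrN.
  by apply: eq_bigr => j _; rewrite -scalemxAl mxtraceZ.
have : \sum_i sqnorm (Z i + Y i) = 0.
  under eq_bigr do rewrite sqnormD.
  by rewrite !big_split /= cross normZ; ring.
move/psumr_eq0P => /(_ (fun i _ => sqnorm_ge0 _) i isT) /eqP.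
rewrite sqnorm_eq0 /Z /Y /mxcomm addrACA -mulmxDl -opprD -mulmxDr subr_eq0.
by rewrite addrC => /eqP.
Qed.

(** [b *: J = S - a%:M] is symmetric, so its squared norm is the trace of its square,
    [- b^2 n <= 0]. *)
Lemma symmx_complex_scalar (R : realFieldType) n (S J : 'M[R]_n) a b :
  S^T = S -> J *m J = - 1%:M -> S = a%:M + b *: J -> S = a%:M.
Proof.
move=> ST JJ SE; rewrite SE; suff -> : b *: J = 0 by rewrite addr0.
apply/eqP; rewrite -sqnorm_eq0 eq_le sqnorm_ge0 andbT /sqnorm.
have -> : (b *: J)^T = b *: J.
  have -> : b *: J = S - a%:M by rewrite SE addrAC subrr add0r.
  by rewrite linearB /= ST tr_scalar_mx.
rewrite -scalemxAl -scalemxAr JJ scalerA linearZ linearN /= mxtrace1 mulrN.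
by rewrite oppr_le0 mulr_ge0 // -expr2 sqr_ge0.
Qed.

(** In the basis given by a minimiser [g], the symmetric part of each matrix commutes with the whole
    family; the commutant hypothesis makes it a scalar, which the vanishing trace forces to be
    [0]. *)
Lemma skew_conjugate (R : realType) n d (A : 'I_d -> 'M[R]_n)
    (c : 'I_d -> 'I_d -> 'I_d -> R) (J : 'M[R]_n) :
    (0 < n)%N ->
    (forall k i j, c k i j = - c k j i) ->
    (forall k i, mxcomm (A k) (A i) = \sum_j c k i j *: A j) ->
    (forall i, \tr (A i) = 0) ->
    J *m J = - 1%:M ->
    (forall S, (forall i, S *m A i = A i *m S) ->
       exists a b, S = a%:M + b *: J) ->
    (forall g X, g != 0 -> (forall i, A i *m g = g *m X i) -> g \in unitmx) ->
  exists2 g : 'M[R]_n, g \in unitmx &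
    forall i, (invmx g *m A i *m g)^T = - (invmx g *m A i *m g).
Proof.
move=> n_gt0 c_skew A_br A_tr JJ A_cent A_irr.
have [g [X [g0 gX Xmin]]] := exists_minimal_conjugate A n_gt0.
have gU := A_irr _ _ g0 gX.
exists g => // k.
have XE i : invmx g *m A i *m g = X i by rewrite -mulmxA gX mulKmx.
have AE i : A i = g *m X i *m invmx g by rewrite -gX mulmxK.
have X_moment : \sum_i X i *m (X i)^T = \sum_i (X i)^T *m X i.
  (* [g *m h] intertwines [A] with the conjugate of [X] by [h], so [X] is minimal among its own
     conjugates. *)
  apply: minimal_moment => h hU; apply: (Xmin (g *m h)) => [|i].
    by apply: contraNneq g0 => gh0; rewrite -(mulmxK hU g) gh0 mul0mx.
  by rewrite mulmxA gX !mulmxA mulmxK.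
have X_br k1 i : mxcomm (X k1) (X i) = \sum_j c k1 i j *: X j.
  have -> : \sum_j c k1 i j *: X j = invmx g *m mxcomm (A k1) (A i) *m g.
    rewrite A_br mulmx_sumr mulmx_suml; apply: eq_bigr => j _.
    by rewrite -scalemxAr -scalemxAl XE.
  rewrite /mxcomm mulmxBr mulmxBl -!XE !mulmxA.
  by rewrite !mulmxK.
have S_comm := moment_comm_sym c_skew X_br X_moment k.
set S := X k + (X k)^T in S_comm.
have ST : S^T = S by rewrite linearD /= trmxK addrC.
have [|a [b SE]] := A_cent (g *m S *m invmx g).
  by move=> i; rewrite AE !mulmxA !mulmxKV // -(mulmxA g S) S_comm !mulmxA.
pose J' := invmx g *m J *m g.
have J'J' : J' *m J' = - 1%:M.
  by rewrite /J' !mulmxA mulmxK // -(mulmxA _ J J) JJ mulmxN mulmx1 mulNmx mulVmx.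
have SE' : S = a%:M + b *: J'.
  have -> : S = invmx g *m (g *m S *m invmx g) *m g.
    by rewrite !mulmxA mulVmx // mul1mx mulmxKV.
  rewrite SE mulmxDr mulmxDl -scalemxAr -scalemxAl mul_mx_scalar -scalemxAl.
  by rewrite mulVmx // scalemx1.
have Sa := symmx_complex_scalar ST J'J' SE'.
have : \tr S = 0.
  rewrite linearD /= mxtrace_tr -XE mxtrace_mulC mulmxA mulmxV // mul1mx.
  by rewrite A_tr addr0.
rewrite Sa mxtrace_scalar => /eqP; rewrite mulrn_eq0 -(negbK (n == 0)) -lt0n n_gt0.
move=> /= /eqP a0; apply/eqP.
by rewrite XE -addr_eq0 addrC -/S Sa a0 raddf0.
Qed.

(** * Euclidean products on vector spaces and Lie algebras *)

Section Linear.
Variables (R : pzRingType) (V W : lmodType R) (f : V -> W).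
Hypothesis f_lin : linear f.

(** Representations, brackets and forms are bare functions with a proof of linearity; bundling them
    gives access to the theory of linear maps. *)
Let fL : {linear V -> W} := HB.pack f (GRing.isLinear.Build R V W _ f f_lin).

Lemma lin0 : f 0 = 0. Proof. exact: (linear0 fL). Qed.
Lemma linD x y : f (x + y) = f x + f y. Proof. exact: (linearD fL). Qed.
Lemma linN x : f (- x) = - f x. Proof. exact: (linearN fL). Qed.
Lemma linB x y : f (x - y) = f x - f y. Proof. exact: (linearB fL). Qed.
Lemma linZ a x : f (a *: x) = a *: f x. Proof. exact: (linearZ_LR fL). Qed.
Lemma lin_sum I (r : seq I) (P : pred I) (F : I -> V) :
  f (\sum_(i <- r | P i) F i) = \sum_(i <- r | P i) f (F i).
Proof. exact: (linear_sum fL). Qed.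

End Linear.

Section Euclidean.
Variables (R : realType) (V : vectType R) (B : V -> V -> R).
Hypothesis B_eucl : is_euclidean B.

Let Bl (w : V) : linear (B^~ w : V -> R^o) := euclidean_linear B_eucl w.

Lemma euclC v w : B v w = B w v. Proof. exact: euclidean_sym. Qed.

Lemma eucl0l w : B 0 w = 0. Proof. exact: (lin0 (Bl w)). Qed.
Lemma euclDl u v w : B (u + v) w = B u w + B v w.
Proof. exact: (linD (Bl w)). Qed.
Lemma euclNl v w : B (- v) w = - B v w. Proof. exact: (linN (Bl w)). Qed.
Lemma euclZl a v w : B (a *: v) w = a * B v w. Proof. exact: (linZ (Bl w)). Qed.
Lemma eucl_suml I (r : seq I) (P : pred I) (F : I -> V) w :
  B (\sum_(i <- r | P i) F i) w = \sum_(i <- r | P i) B (F i) w.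
Proof. exact: (lin_sum (Bl w)). Qed.

Lemma eucl0r w : B w 0 = 0. Proof. by rewrite euclC eucl0l. Qed.
Lemma euclDr u v w : B w (u + v) = B w u + B w v.
Proof. by rewrite !(euclC w) euclDl. Qed.
Lemma euclNr v w : B w (- v) = - B w v. Proof. by rewrite !(euclC w) euclNl. Qed.
Lemma euclZr a v w : B w (a *: v) = a * B w v.
Proof. by rewrite !(euclC w) euclZl. Qed.
Lemma eucl_sumr I (r : seq I) (P : pred I) (F : I -> V) w :
  B w (\sum_(i <- r | P i) F i) = \sum_(i <- r | P i) B w (F i).
Proof. by rewrite euclC eucl_suml; apply: eq_bigr => i _; rewrite euclC. Qed.

Lemma eucl_ge0 v : 0 <= B v v.
Proof.
have [->|v0] := eqVneq v 0; first by rewrite eucl0l.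
exact/ltW/(euclidean_pos B_eucl).
Qed.

Lemma eucl_eq0 v : (B v v == 0) = (v == 0).
Proof.
have [->|v0] := eqVneq v 0; first by rewrite eucl0l eqxx.
by rewrite gt_eqF // (euclidean_pos B_eucl).
Qed.

Lemma eucl_nondeg v : (forall w, B v w = 0) -> v = 0.
Proof. by move=> v0; apply/eqP; rewrite -eucl_eq0 v0. Qed.

Lemma eucl_inj v w : (forall u, B u v = B u w) -> v = w.
Proof.
move=> vw; apply/eqP; rewrite -subr_eq0; apply/eqP/eucl_nondeg => u.
by rewrite euclC euclDr euclNr vw subrr.
Qed.

Definition orthonormal_basis (e : 'I_(\dim {:V}) -> V) :=
  (forall i j, B (e i) (e j) = (i == j)%:R) /\
  (forall v, v = \sum_i B v (e i) *: e i).

(** Gram-Schmidt by dimension count: pairing with [k < \dim] vectors has a nonzero kernel, and a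
    unit vector of it extends the family. Values at indices beyond [k] are arbitrary. *)
Lemma orthonormal_family k : (k <= \dim {:V})%N ->
  exists e : nat -> V,
    forall i j, (i < k)%N -> (j < k)%N -> B (e i) (e j) = (i == j)%:R.
Proof.
elim: k => [_|k IH lt_k]; first by exists (fun=> 0).
have [e eP] := IH (ltnW lt_k).
pose L0 (v : V) : 'rV[R]_k := \row_i B v (e i).
have L0_lin : linear L0.
  by move=> a x y; apply/rowP => i; rewrite !mxE euclDl euclZl.
pose L : {linear V -> 'rV[R]_k} :=
  HB.pack L0 (GRing.isLinear.Build _ _ _ _ L0 L0_lin).
have kerL : lker (linfun L) != 0%VS.
  rewrite -dimv_eq0 -lt0n; have := limg_ker_dim (linfun L) {:V}.
  rewrite capfv => /eqP; rewrite addnC => dimE.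
  have : (\dim (limg (linfun L)) <= k)%N.
    apply: leq_trans (dimvS (subvf _)) _; rewrite dimvf dim_matrix.
    by rewrite mul1r.
  move=> le_k; rewrite -(ltn_add2l k) addn0; apply: leq_trans lt_k _.
  by rewrite -(eqP dimE) leq_add2r.
pose v := vpick (lker (linfun L)).
have v0 : v != 0 by rewrite vpick0.
have v_orth i : (i < k)%N -> B v (e i) = 0.
  move=> ik; have : v \in lker (linfun L) by exact: memv_pick.
  rewrite memv_ker lfunE /= => /eqP/rowP/(_ (Ordinal ik)).
  by rewrite !mxE.
have Bv_gt0 : 0 < B v v by exact: euclidean_pos.
pose r := (Num.sqrt (B v v))^-1.
have rr : r * r * B v v = 1.
  by rewrite -expr2 /r exprVn sqr_sqrtr ?(ltW Bv_gt0) // mulVf // gt_eqF.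
exists (fun i => if i == k then r *: v else e i) => i j.
rewrite !ltnS [(i <= k)%N]leq_eqVlt [(j <= k)%N]leq_eqVlt.
case: (eqVneq i k) => [->|ik] /=; case: (eqVneq j k) => [->|jk] //= Hi Hj.
- by rewrite euclZl euclZr mulrA rr.
- by rewrite euclZl v_orth // mulr0.
- by rewrite euclZr euclC v_orth // mulr0 (negPf ik).
- exact: eP.
Qed.

Lemma orthonormal_basis_exists : exists e, orthonormal_basis e.
Proof.
have [e eP] := orthonormal_family (leqnn _).
exists (fun i => e i); set n := \dim {:V}.
have eE (i j : 'I_n) : B (e i) (e j) = (i == j)%:R by exact: eP.
split=> // v.
pose X := [tuple e i | i < n].
have Xi (i : 'I_n) : X`_i = e i by rewrite -tnth_nth tnth_mktuple.
(* Orthonormality forces freeness, and a free family of [\dim] vectors is a basis. *)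
have X_free : free X.
  apply/freeP => c c0 i; have := congr1 (B (e i)) c0.
  rewrite eucl_sumr eucl0r (bigD1 i) //= big1 ?addr0 => [|j ji].
    by rewrite Xi euclZr eE eqxx mulr1.
  by rewrite Xi euclZr eE eq_sym (negPf ji) mulr0.
have X_basis : basis_of {:V} X by rewrite basisEfree X_free subvf size_tuple /=.
have vE := coord_basis X_basis (memvf v).
rewrite {1}vE; apply: eq_bigr => i _; rewrite Xi; congr (_ *: _).
rewrite [in RHS]vE eucl_suml (bigD1 i) //= big1 ?addr0 => [|j ji].
  by rewrite Xi euclZl eE eqxx mulr1.
by rewrite Xi euclZl eE (negPf ji) mulr0.
Qed.

Lemma parseval e v w : orthonormal_basis e ->
  \sum_i B v (e i) * B w (e i) = B v w.
Proof.
move=> [_ eE]; rewrite [in RHS](eE w) eucl_sumr.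
by apply: eq_bigr => i _; rewrite euclZr mulrC.
Qed.

End Euclidean.

(** * Centre and perfectness of a semi-simple algebra *)

Section Perfect.
Variables (R : realType) (h : lieAlgType R) (Bh : h -> h -> R).
Hypothesis h_semisimple : is_semisimple h.
Hypothesis Bh_inv : is_ad_invariant_euclidean Bh.

Lemma lieC (x y : h) : lie x y = - lie y x.
Proof.
apply/eqP; rewrite -addr_eq0; apply/eqP.
have := liexx (x + y); rewrite (linD (lie_linearl _)) !(linD (lie_linearr _)).
by rewrite !liexx add0r addr0.
Qed.

Lemma lie_form x y z : Bh (lie x y) z = - Bh y (lie x z).
Proof. by apply/eqP; rewrite -addr_eq0; apply/eqP; apply: Bh_inv.2. Qed.

(** The line through a central element is an abelian ideal, solvable in one step. *)
Lemma center_trivial (t : h) : (forall x, lie x t = 0) -> t = 0.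
Proof.
move=> t_central; suff : (<[t]> = 0)%VS.
  by move=> t0; apply/eqP; rewrite -memv0 -t0 memv_line.
apply: h_semisimple => [x u /vlineP[k ->]|].
  by rewrite (linZ (lie_linearr x)) t_central scaler0 mem0v.
exists 1%N; apply/eqP; rewrite -subv0; apply/span_subvP => w.
case/allpairsP => [[u v] /= [uU vU ->]]; move/vbasis_mem: vU => /vlineP[k ->].
by rewrite (linZ (lie_linearr u)) t_central scaler0 mem0v.
Qed.

(** Write [phi] as the product with a vector [t]; then [t] is orthogonal to all brackets, hence
    central by invariance of the product, hence [0]. *)
Lemma perfect (phi : h -> R) :
  scalar phi -> (forall x y, phi (lie x y) = 0) -> forall x, phi x = 0.
Proof.
move=> phi_lin phi_lie.
have phiL : linear (phi : h -> R^o) := phi_lin.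
have [e [_ eE]] := orthonormal_basis_exists Bh_inv.1.
pose t := \sum_i phi (e i) *: e i.
have phiE x : phi x = Bh x t.
  rewrite /t (eucl_sumr Bh_inv.1) {1}(eE x) [LHS](lin_sum phiL).
  apply: eq_bigr => i _; rewrite [LHS](linZ phiL) (euclZr Bh_inv.1).
  exact: mulrC.
have t0 : t = 0.
  apply: center_trivial => x; apply: (eucl_nondeg Bh_inv.1) => z.
  by rewrite lie_form (euclC Bh_inv.1) -phiE phi_lie oppr0.
by move=> x; rewrite phiE t0 (eucl0r Bh_inv.1).
Qed.

End Perfect.

Import passmx.

(** * Commutant of a representation of complex type *)

Section Commutant.
Variables (R : realType) (h : lieAlgType R) (m : vectType R).
Variables (rho : h -> 'End(m)) (I : 'End(m)).
Hypothesis rho_complex : is_complex_type rho.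
Hypothesis I_complex : is_invariant_complex_structure rho I.

(** [I] is the image of some [u + i v] of square [-1], which forces [u = 0] and [v^2 = 1]; so the
    identity and [I] span the image of the complex numbers. *)
Lemma commutant_complex f : centralizes rho f ->
  exists a b, f = a *: \1%VF + b *: I.
Proof.
have [phi [phiD phiZ [phi1 phiM] phi_inj phiP]] := rho_complex.
have [Icent II] := I_complex.
move=> /phiP[[x y] ->]; have [[u v] IE] := (phiP I).1 Icent.
have phiC a : phi (a%:C)%C = a *: \1%VF.
  by rewrite -[(a%:C)%C]mulr1 phiZ phi1.
have : phi ((u +i* v)%C * (u +i* v)%C) = phi ((-1)%:C)%C.
  by rewrite phiM -IE II phiC scaleN1r.
move=> /phi_inj; simpc => -[uv1 uv2].
have u0 : u = 0.
  have : u * v = 0 by lra.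
  move/eqP; rewrite mulf_eq0 => /orP[/eqP//|/eqP v0].
  move: uv1; rewrite v0; have := sqr_ge0 u; nra.
have vv : v * v = 1 by move: uv1; rewrite u0; lra.
exists x, (y * v); rewrite IE -phiC -phiZ -phiD; congr (phi _).
by rewrite u0; simpc; rewrite -mulrA vv mulr1.
Qed.

Lemma complex_structure_sqr v : I (I v) = - v.
Proof. by rewrite -comp_lfunE I_complex.2 opp_lfunE id_lfunE. Qed.

Lemma complex_structure_comm x v : I (rho x v) = rho x (I v).
Proof. by rewrite -!comp_lfunE I_complex.1. Qed.

End Commutant.

Lemma mxof1 (F : fieldType) (V : vectType F) (e : (\dim {:V}).-tuple V) :
  basis_of {:V} e -> mxof e e \1%VF = 1%:M.
Proof.
move=> eB; apply/row_matrixP => i; rewrite !rowE mul_mxof id_lfunE vecofK //.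
by rewrite mulmx1.
Qed.

(** * Invariant Euclidean product on the representation *)

Section InvariantForm.
Variables (R : realType) (h : lieAlgType R) (m : vectType R).
Variables (Bh : h -> h -> R) (rho : h -> 'End(m)) (I : 'End(m)).
Hypothesis h_semisimple : is_semisimple h.
Hypothesis Bh_inv : is_ad_invariant_euclidean Bh.
Hypothesis rho_rep : is_rep rho.
Hypothesis rho_irr : is_irreducible rho.
Hypothesis rho_complex : is_complex_type rho.
Hypothesis I_complex : is_invariant_complex_structure rho I.

Let rho_lin := rep_linear rho_rep.

Lemma rho_lie_app x y v : rho (lie x y) v = rho x (rho y v) - rho y (rho x v).
Proof. by rewrite (rep_lie rho_rep) add_lfunE opp_lfunE !comp_lfunE. Qed.

(** Transports [skew_conjugate] to [rho]; perfectness supplies the vanishing traces. *)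
Theorem invariant_euclidean_exists :
  exists BV, is_euclidean BV /\ is_invariant_form (fun x => rho x) BV.
Proof.
have [f [fE fspan]] := orthonormal_basis_exists Bh_inv.1.
pose e := vbasis {:m}; have eB : basis_of {:m} e := vbasisP _.
pose M x := mxof e e (rho x).
have M_lin : linear M by move=> a x y; rewrite /M rho_lin linearP.
(* Matrices act on row vectors, so composition is reversed; hence the reversed brackets in [M_lie]
   and in the structure constants [c]. *)
have M_comp x y : mxof e e (rho x \o rho y)%VF = M y *m M x.
  by rewrite (mxof_comp _ _ eB).
have M_lie x y : mxcomm (M x) (M y) = M (lie y x).
  by rewrite /mxcomm -!M_comp /M (rep_lie rho_rep) linearB.
pose c k i j := Bh (lie (f i) (f k)) (f j).
have M_tr x : \tr (M x) = 0.
  apply: (perfect h_semisimple Bh_inv (phi := fun x => \tr (M x))) => [a y z|y z].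
    by rewrite M_lin linearP.
  by rewrite -M_lie /mxcomm linearB /= mxtrace_mulC subrr.
have [_ II] := I_complex.
have JJ : mxof e e I *m mxof e e I = - 1%:M.
  by rewrite -(mxof_comp _ _ eB) II linearN /= (mxof1 eB).
have M_gen S : (forall i, S *m M (f i) = M (f i) *m S) ->
    forall x, S *m M x = M x *m S.
  move=> S_comm x; rewrite (fspan x) (lin_sum M_lin) mulmx_sumr mulmx_suml.
  by apply: eq_bigr => i _; rewrite (linZ M_lin) -scalemxAr -scalemxAl S_comm.
have [|k i|S S_comm|g X g0 gX|g gU g_skew] :=
  @skew_conjugate R (\dim {:m}) (\dim {:h}) (fun i => M (f i)) c (mxof e e I)
    rho_irr.1 _ _ (fun i => M_tr (f i)) JJ.
- move=> k i j; rewrite /c ![lie _ (f k)]lieC !(euclNl Bh_inv.1).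
  by rewrite (lie_form Bh_inv) !opprK (euclC Bh_inv.1).
- rewrite M_lie [lie _ _]fspan (lin_sum M_lin).
  by apply: eq_bigr => j _; rewrite (linZ M_lin).
- have [|a [b SE]] := 
    commutant_complex rho_complex I_complex (f := hommx e e S).
    move=> x; apply: (can_inj (mxofK eB eB)).
    by rewrite !(mxof_comp _ _ eB) (hommxK eB eB) -/(M x) (M_gen S).
  exists a, b; rewrite -[S](hommxK eB eB) SE linearD !linearZ /= (mxof1 eB).
  by rewrite scalemx1.
(* Invertibility of a nonzero intertwiner: if [v *m g = 0] then [v *m A i *m g = v *m g *m X i = 0],
   so its kernel is a subrepresentation. *)
- pose G := hommx e e g.
  have G_stable x : (rho x @: lker G <= lker G)%VS.
    apply/subvP => _ /memv_imgP[v vG ->]; move: vG; rewrite !memv_ker => /eqP Gv.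
    have Gv0 : rVof e v *m g = 0.
      by apply/eqP; rewrite -(vecof_eq0 eB) -(hommxE eB eB) Gv.
    rewrite /G (hommxE eB eB) vecof_eq0 // (rVof_app _ eB) -/(M x).
    rewrite (fspan x) (lin_sum M_lin) mulmx_sumr mulmx_suml big1 // => i _.
    rewrite (linZ M_lin) -scalemxAr -scalemxAl -mulmxA gX mulmxA Gv0.
    by rewrite mul0mx scaler0.
  have [ker0|kerT] := rho_irr.2 _ G_stable.
    have := lker0_compVf (introT eqP ker0) => /(congr1 (mxof e e)).
    rewrite (mxof_comp _ _ eB) (hommxK eB eB) (mxof1 eB).
    by move/mulmx1_unit => [].
  case/negP: g0; rewrite -(hommx_eq0 eB eB) -/G; apply/eqP/lfunP => v.
  by apply/eqP; rewrite zero_lfunE -memv_ker kerT memvf.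
(* Coordinates in which all of [rho] is skew; the invariant product is the standard dot product of
   these. *)
pose y v := rVof e v *m g.
have y_lin : linear y by move=> a u v; rewrite /y linearP /= mulmxDl scalemxAl.
exists (fun v w => (y v *m (y w)^T) 0 0); split.
  split=> [w a u v|v w|v v0].
  - by rewrite y_lin mulmxDl -scalemxAl !mxE.
  - by rewrite -[in RHS](trmxK (y w)) -trmx_mul [in RHS]mxE.
  - have -> : (y v *m (y v)^T) 0 0 = sqnorm (y v).
      by rewrite /sqnorm /mxtrace big_ord1.
    rewrite lt_def sqnorm_ge0 sqnorm_eq0 andbT; apply: contra v0 => /eqP yv.
    by rewrite -(rVof_eq0 eB) -[rVof e v](mulmxK gU) -/(y v) yv mul0mx.
move=> x v w; rewrite /y !(rVof_app _ eB) -/(M x).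
pose N z := invmx g *m M z *m g.
have N_skew : (N x)^T = - N x.
  have N_lin : linear N.
    by move=> a z z'; rewrite /N M_lin mulmxDr mulmxDl -scalemxAr -scalemxAl.
  rewrite (fspan x) (lin_sum N_lin) linear_sum -sumrN /=.
  by apply: eq_bigr => i _; rewrite (linZ N_lin) linearZ /= g_skew scalerN.
have yN u : rVof e u *m M x *m g = y u *m N x by rewrite /y /N !mulmxA mulmxK.
rewrite !yN -[_ *m g]/(y w) -[rVof e v *m g]/(y v).
by rewrite (trmx_mul (y w)) N_skew mulNmx mulmxN !mulmxA [X in _ + X]mxE subrr.
Qed.

(** The adjoint [It] of [I] commutes with [rho], so it is [a + b I]; positivity of the product
    leaves only [a = 0] and [b = -1]. *)
Lemma complex_structure_skew BV :
    is_euclidean BV -> is_invariant_form (fun x => rho x) BV ->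
  forall v w, BV (I v) w = - BV v (I w).
Proof.
move=> BV_eucl BV_inv.
have [e [eO eE]] := orthonormal_basis_exists BV_eucl.
pose It v := \sum_i BV v (I (e i)) *: e i.
have ItE v w : BV (It v) w = BV v (I w).
  rewrite (eucl_suml BV_eucl) [in RHS](eE w) linear_sum (eucl_sumr BV_eucl) /=.
  apply: eq_bigr => i _; rewrite linearZ /= (euclZl BV_eucl) (euclZr BV_eucl).
  by rewrite mulrC (euclC BV_eucl w).
have It_lin : linear It.
  move=> a u v; apply: (eucl_inj BV_eucl) => w.
  by rewrite (euclDr BV_eucl) (euclZr BV_eucl) !(euclC BV_eucl w) !ItE
     (euclDl BV_eucl) (euclZl BV_eucl).
pose L : {linear m -> m} := HB.pack It (GRing.isLinear.Build _ _ _ _ It It_lin).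
have [|a [b LE]] := commutant_complex rho_complex I_complex (f := linfun L).
  move=> x; apply/lfunP => v; rewrite !comp_lfunE !lfunE /=.
  apply: (eucl_inj BV_eucl) => w; rewrite (euclC BV_eucl) ItE.
  have rho_skew u u' : BV (rho x u) u' = - BV u (rho x u').
    by apply/eqP; rewrite -addr_eq0 BV_inv.
  rewrite rho_skew -(complex_structure_comm I_complex) -ItE.
  by rewrite [in RHS](euclC BV_eucl) rho_skew.
have IvE v w : BV v (I w) = a * BV v w + b * BV (I v) w.
  rewrite -ItE; have -> : It v = a *: v + b *: I v.
    by rewrite -[It v]/(L v) -lfunE LE add_lfunE !scale_lfunE id_lfunE.
  by rewrite (euclDl BV_eucl) !(euclZl BV_eucl).
have [v v0] : exists v : m, v != 0.
  exists (vpick {:m}); rewrite vpick0 -dimv_eq0 -lt0n; exact: rho_irr.1.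
have Bv : 0 < BV v v by apply: euclidean_pos.
have Iv0 : 0 < BV (I v) (I v).
  apply: (euclidean_pos BV_eucl); apply: contra_neq v0 => Iv.
  by apply/eqP; rewrite -oppr_eq0 -(complex_structure_sqr I_complex) Iv linear0.
have IIE u u' : BV (I (I u)) u' = - BV u u'.
  by rewrite (complex_structure_sqr I_complex) (euclNl BV_eucl).
have II' u u' : BV u (I (I u')) = - BV u u'.
  by rewrite (complex_structure_sqr I_complex) (euclNr BV_eucl).
have sC : BV (I v) v = BV v (I v) by apply: euclC.
(* Test on the pairs [(v, I v)] and [(I v, v)] for [b], then on [(v, v)] and [(I v, I v)] for
   [a]. *)
have b1 : b = - 1.
  have := IvE v (I v); have := IvE (I v) v; rewrite II' IIE sC => E3 E2.
  have : (BV v v + BV (I v) (I v)) * (b + 1) = 0 by lra.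
  move/eqP; rewrite mulf_eq0 gt_eqF ?addr_gt0 //= addr_eq0 => /eqP //.
have a0 : a = 0.
  have := IvE v v; have := IvE (I v) (I v).
  rewrite II' IIE sC b1 => E5 E1.
  have : (BV v v + BV (I v) (I v)) * a = 0 by lra.
  by move/eqP; rewrite mulf_eq0 gt_eqF ?addr_gt0 //= => /eqP.
move=> x y; rewrite IvE a0 b1; lra.
Qed.

End InvariantForm.

(** * Invariant alternating forms and multivectors *)

Section InvariantForms.
Variables (R : realType) (k : nat) (V : vectType R) (B : V -> V -> R).
Variable (e : 'I_(\dim {:V}) -> V).
Hypothesis B_eucl : is_euclidean B.
Hypothesis e_basis : orthonormal_basis B e.

Local Notation n := (\dim {:V}).

Let tup (s : {ffun 'I_k -> 'I_n}) : {ffun 'I_k -> V} := [ffun i => e (s i)].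

Let set_at (s : {ffun 'I_k -> 'I_n}) i c : {ffun 'I_k -> 'I_n} :=
  [ffun j => if j == i then c else s j].

Lemma tup_set_at s i c : upd (tup s) i (e c) = tup (set_at s i c).
Proof. by apply/ffunP => j; rewrite !ffunE; case: eqP. Qed.

(* The multivector corresponding to the form [T] under the Euclidean
   identification of a space with its dual. *)
Definition sharp (T : {ffun 'I_k -> V} -> R^o) : ext_power k V :=
  \sum_s T (tup s) *: wedge (tup s).

Lemma sharpB T T' c : sharp (fun v => T v - c * T' v) = sharp T - c *: sharp T'.
Proof.
rewrite /sharp scaler_sumr -sumrB; apply: eq_bigr => s _.
by rewrite scalerBl scalerA.
Qed.

Lemma upd_expand (W : lmodType R) (f : {ffun 'I_k -> V} -> W) s i x :
  is_multilinear f ->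
  f (upd (tup s) i x) = \sum_c B x (e c) *: f (tup (set_at s i c)).
Proof.
move=> f_lin; rewrite {1}(e_basis.2 x) (multilinear_sum f_lin).
by apply: eq_bigr => c _; rewrite tup_set_at.
Qed.

(** Skewness of [X] moves its action from the wedge factors to the arguments of [T], where it
    vanishes by hypothesis. *)
Lemma sharp_invariant (T : {ffun 'I_k -> V} -> R^o) (X : 'End(V)) :
    is_multilinear T -> (forall u v, B (X u) v = - B u (X v)) ->
    (forall v, \sum_i T (upd v i (X (v i))) = 0) ->
  ext_der k X (sharp T) = 0.
Proof.
move=> T_lin X_skew T_inv.
rewrite /sharp linear_sum /=.
under eq_bigr => s _ do rewrite linearZ /= ext_der_wedge scaler_sumr.
rewrite exchange_big /=.
transitivity (\sum_i \sum_s (- T (upd (tup s) i (X (tup s i)))) *: wedge (tup s)).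
  apply: eq_bigr => i _.
  have wedge_lin := @wedge_multilinear R k V.
  under eq_bigr => s _ do rewrite (upd_expand _ _ _ wedge_lin) scaler_sumr.
  under [RHS]eq_bigr => s _ do rewrite (upd_expand _ _ _ T_lin) -sumrN scaler_suml.
  rewrite !pair_big /=.
  (* Exchanges the index in slot [i] with the summation index of the expansion of [X (e (s i))];
     skewness accounts for the sign. *)
  pose sw (p : {ffun 'I_k -> 'I_n} * 'I_n) := (set_at p.1 i p.2, p.1 i).
  have swK : involutive sw.
    case=> s c; rewrite /sw /= ffunE eqxx; congr (_, _).
    by apply/ffunP => j; rewrite !ffunE; case: eqP => [->|].
  rewrite (reindex_inj (inv_inj swK)) /=; apply: eq_bigr => -[s c] _ /=.
  have -> : set_at (set_at s i c) i (s i) = s.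
    by apply/ffunP => j; rewrite !ffunE; case: eqP => [->|].
  rewrite scalerA !ffunE eqxx [B (X (e (s i))) _]X_skew; congr (_ *: _).
  by rewrite (euclC B_eucl (e (s i))) scaleNr opprK mulrC.
rewrite exchange_big big1 // => s _.
by rewrite -scaler_suml sumrN T_inv oppr0 scale0r.
Qed.

Lemma multilinear_eq0 (T : {ffun 'I_k -> V} -> R^o) :
  is_multilinear T -> (forall s, T (tup s) = 0) -> forall v, T v = 0.
Proof.
move=> T_lin T0 v.
suff main m : forall v : {ffun 'I_k -> V},
    (forall i : 'I_k, (m <= i)%N -> exists j, v i = e j) -> T v = 0.
  by apply: (main k) => i; rewrite leqNgt ltn_ord.
elim: m => [|m IHm] {}v Hv.
  have /fin_all_exists [s Hs] : forall i, exists j, v i = e j.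
    by move=> i; apply: Hv.
  rewrite -(T0 [ffun i => s i]); congr T.
  by apply/ffunP => i; rewrite !ffunE.
have [mk|km] := ltnP m k; last first.
  by apply: IHm => i mi; have := leq_trans (ltn_ord i) km; rewrite ltnNge mi.
pose i := Ordinal mk.
rewrite -(upd_id v i) {1}(e_basis.2 (v i)) (multilinear_sum T_lin) big1 // => j _.
rewrite IHm ?scaler0 // => l ml; rewrite ffunE.
case: eqP => [_|/eqP li]; first by exists j.
by apply: Hv; rewrite ltn_neqAle ml andbT eq_sym.
Qed.

(** The linear map induced by [T] sends [sharp T] to the sum of the squares of the coefficients of
    [T]. *)
Lemma sharp_eq0 (T : {ffun 'I_k -> V} -> R^o) :
  is_multilinear T -> is_alternating T -> sharp T = 0 -> forall v, T v = 0.
Proof.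
move=> T_lin T_alt /(congr1 (ext_lift T)); rewrite linear0 /sharp linear_sum /=.
under eq_bigr => s _ do rewrite linearZ /= ext_lift_wedge //.
move=> S0; apply: multilinear_eq0 => // s; apply/eqP.
rewrite -sqrf_eq0 expr2; apply/eqP.
by apply: (psumr_eq0P _ S0) => // t _; rewrite -[_ *: _]expr2 sqr_ge0.
Qed.

End InvariantForms.

(** By pigeonhole every wedge of [k] basis vectors has a repeated factor. *)
Lemma ext_power_eq0 (R : numFieldType) k (V : vectType R) :
  (\dim {:V} < k)%N -> forall w : ext_power k V, w = 0.
Proof.
move=> lt w.
pose z : {linear ext_power k V -> ext_power k V} := \0.
pose o : {linear ext_power k V -> ext_power k V} := idfun.
suff /(_ w) : o =1 z by [].
apply: ext_power_eq => v /=.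
apply: (multilinear_ind (@wedge_multilinear R k V)
  (P := fun x => x = 0)) => // [a x y -> ->|s]; first by rewrite scaler0 addr0.
have [i [j ij sij]] : exists i, exists2 j, i != j & s i = s j.
  have : ~~ injectiveb s.
    apply/negP => /injectiveP/leq_card.
    by rewrite !card_ord leqNgt lt.
  by case/injectivePn => i [j ij sij]; exists i, j.
by apply: (wedge_alternating ij); rewrite !ffunE sij.
Qed.

Lemma dim1_colinear (R : fieldType) (V : vectType R) (U : {vspace V}) x y :
  \dim U = 1%N -> x \in U -> y \in U -> y != 0 -> exists c, x = c *: y.
Proof.
move=> U1 xU yU y0; have : (<[y]> == U)%VS.
  by rewrite eqEdim -memvE yU U1 dim_vline y0.
by move=> /eqP UE; move: xU; rewrite -UE => /vlineP.
Qed.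

(** * The 4-form attached to a skew bilinear map *)

Section CyclicForm.
Variables (R : realType) (V K : vectType R) (B : K -> K -> R) (mu : V -> V -> K).
Hypothesis B_eucl : is_euclidean B.
Hypothesis mu_linear : forall w, linear (mu^~ w).
Hypothesis mu_skew : forall v w, mu v w = - mu w v.

(** For a moment map, the Jacobi sum of [a], [b], [c] paired with [d]; for a real 2-form [mu], its
    exterior square up to a constant. *)
Definition cyclic_form (a b c d : V) : R :=
  B (mu a b) (mu c d) + B (mu b c) (mu a d) + B (mu c a) (mu b d).

Definition cyclic_4form (v : {ffun 'I_4 -> V}) : R^o :=
  cyclic_form (v (inord 0)) (v (inord 1)) (v (inord 2)) (v (inord 3)).

Lemma mu_linear_r v : linear (mu v).
Proof. move=> a x y; rewrite (mu_skew v) (mu_skew v x) (mu_skew v y) mu_linear.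
by rewrite scalerN opprD. Qed.


Lemma cyclic_form_swap12 a b c d : cyclic_form b a c d = - cyclic_form a b c d.
Proof.
rewrite /cyclic_form (mu_skew b a) (mu_skew a c) (mu_skew c b).
by rewrite !(euclNl B_eucl); ring.
Qed.

Lemma cyclic_form_swap23 a b c d : cyclic_form a c b d = - cyclic_form a b c d.
Proof.
rewrite /cyclic_form (mu_skew a c) (mu_skew c b) (mu_skew b a).
by rewrite !(euclNl B_eucl); ring.
Qed.

Lemma cyclic_form_swap34 a b c d : cyclic_form a b d c = - cyclic_form a b c d.
Proof.
rewrite /cyclic_form (mu_skew d c) (mu_skew d a) !(euclNr B_eucl) !(euclNl B_eucl).
rewrite (euclC B_eucl (mu b d)) (euclC B_eucl (mu a d)) (mu_skew a c).
by rewrite (euclNl B_eucl); ring.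
Qed.

Lemma cyclic_form_linear1 b c d : scalar (fun a => cyclic_form a b c d).
Proof.
move=> k x y; rewrite /cyclic_form !mu_linear (mu_linear_r c).
by rewrite !(euclDl B_eucl) !(euclDr B_eucl) !(euclZl B_eucl) !(euclZr B_eucl); ring.
Qed.

Lemma cyclic_form_diag12 a c d : cyclic_form a a c d = 0.
Proof. by have := cyclic_form_swap12 a a c d; lra. Qed.

(** Linearity in the first slot is carried to the others by adjacent transpositions. *)
Lemma cyclic_4form_multilinear : is_multilinear cyclic_4form.
Proof.
have L1 k x y b c d : cyclic_form (k *: x + y) b c d =
    k *: (cyclic_form x b c d : R^o) + cyclic_form y b c d.
  exact: cyclic_form_linear1.
have L2 k x y a c d : cyclic_form a (k *: x + y) c d =
    k *: (cyclic_form a x c d : R^o) + cyclic_form a y c d.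
  by rewrite !(cyclic_form_swap12 _ a) L1 scalerN opprD.
have L3 k x y a b d : cyclic_form a b (k *: x + y) d =
    k *: (cyclic_form a b x d : R^o) + cyclic_form a b y d.
  by rewrite !(cyclic_form_swap23 a _ b) L2 scalerN opprD.
have L4 k x y a b c : cyclic_form a b c (k *: x + y) =
    k *: (cyclic_form a b c x : R^o) + cyclic_form a b c y.
  by rewrite !(cyclic_form_swap34 a b _ c) L3 scalerN opprD.
move=> v i k x y; rewrite /cyclic_4form !ffunE -!val_eqE /= !inordK //.
by case: i => -[|[|[|[|i]]]] //= _.
Qed.

Lemma cyclic_4form_alternating : is_alternating cyclic_4form.
Proof.
have D12 := cyclic_form_diag12.
have D23 a b d : cyclic_form a b b d = 0.
  by have := cyclic_form_swap23 a b b d; lra.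
have D34 a b c : cyclic_form a b c c = 0.
  by have := cyclic_form_swap34 a b c c; lra.
have D13 a b d : cyclic_form a b a d = 0.
  by rewrite cyclic_form_swap23 D12 oppr0.
have D24 a b c : cyclic_form a b c b = 0.
  by rewrite cyclic_form_swap34 D23 oppr0.
have D14 a b c : cyclic_form a b c a = 0.
  by rewrite cyclic_form_swap34 D13 oppr0.
move=> v i j; have nthE (l : 'I_4) : v l = v (inord l) by rewrite inord_val.
rewrite (nthE i) (nthE j) -val_eqE /cyclic_4form.
case: i => -[|[|[|[|i]]]] //= _; case: j => -[|[|[|[|j]]]] //= _ _ E;
  by rewrite ?E ?D12 ?D13 ?D14 ?D23 ?D24 ?D34.
Qed.

Lemma cyclic_4form_upd (X : 'End(V)) v :
  \sum_i cyclic_4form (upd v i (X (v i))) =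
  let a := v (inord 0) in let b := v (inord 1) in
  let c := v (inord 2) in let d := v (inord 3) in
  cyclic_form (X a) b c d + cyclic_form a (X b) c d
  + cyclic_form a b (X c) d + cyclic_form a b c (X d).
Proof.
have o0 : ord0 = inord 0 :> 'I_4 by apply/val_inj; rewrite /= inordK.
have o1 : lift ord0 ord0 = inord 1 :> 'I_4 by apply/val_inj; rewrite /= inordK.
have o2 : lift ord0 (lift ord0 ord0) = inord 2 :> 'I_4.
  by apply/val_inj; rewrite /= inordK.
have o3 : lift ord0 (lift ord0 (lift ord0 ord0)) = inord 3 :> 'I_4.
  by apply/val_inj; rewrite /= inordK.
rewrite !big_ord_recl big_ord0 addr0 o3 o2 o1 o0.
by rewrite /cyclic_4form !ffunE -!val_eqE /= !inordK //= !addrA.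
Qed.

(** [X] acts on the values of [mu] through [D], an infinitesimal isometry of [B], so each of the
    three products is separately invariant. *)
Lemma cyclic_4form_invariant (X : 'End(V)) (D : K -> K) :
    (forall x y, B (D x) y + B x (D y) = 0) ->
    (forall u v, mu (X u) v + mu u (X v) = D (mu u v)) ->
  forall v, \sum_i cyclic_4form (upd v i (X (v i))) = 0.
Proof.
move=> D_skew D_mu v; rewrite cyclic_4form_upd /= /cyclic_form.
set a := v _; set b := v _; set c := v _; set d := v _.
have P u1 u2 u3 u4 : B (mu (X u1) u2) (mu u3 u4) + B (mu u1 (X u2)) (mu u3 u4)
    + B (mu u1 u2) (mu (X u3) u4) + B (mu u1 u2) (mu u3 (X u4)) = 0.
  by rewrite -(euclDl B_eucl) -addrA -(euclDr B_eucl) !D_mu D_skew.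
have := P a b c d; have := P b c a d; have := P c a b d; lra.
Qed.

End CyclicForm.

(** * Contraction with the complex structure *)

Section Contraction.
Variables (R : realType) (V : vectType R) (B : V -> V -> R) (I : 'End(V)).
Variable (e : 'I_(\dim {:V}) -> V).
Hypothesis B_eucl : is_euclidean B.
Hypothesis e_basis : orthonormal_basis B e.
Hypothesis I_sqr : forall v, I (I v) = - v.
Hypothesis I_skew : forall v w, B (I v) w = - B v (I w).

(** Evaluates both pairs of slots on the sum of the [e a] tensor [I (e a)], the bivector dual to the
    2-form of [I] up to sign. *)
Definition contraction (T : V -> V -> V -> V -> R) : R :=
  \sum_a \sum_b T (e b) (I (e b)) (e a) (I (e a)).

Lemma I_isometry v w : B (I v) (I w) = B v w.
Proof. by rewrite I_skew I_sqr (euclNr B_eucl) opprK. Qed.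

Section Operator.
Variable A : 'End(V).
Hypothesis A_skew : forall v w, B (A v) w = - B v (A w).
Hypothesis A_comm : forall v, A (I v) = I (A v).

(** The first product factors into the square of a trace; in each of the other two, skewness and
    commutation with [I] turn the double sum into minus a Parseval sum. *)
Lemma contraction_operator :
  contraction (fun a b c d => B (A a) b * B (A c) d + B (A b) c * B (A a) d
                              + B (A c) a * B (A b) d) =
  (\sum_a B (A (e a)) (I (e a))) ^+ 2 - (\sum_a B (A (e a)) (A (e a))) *+ 2.
Proof.
rewrite /contraction.
under eq_bigr => a _ do rewrite !big_split /=.
rewrite !big_split /= mulr2n opprD addrA; congr (_ + _ + _).
- rewrite expr2 mulr_suml; apply: eq_bigr => a _.
  by rewrite mulr_sumr; apply: eq_bigr => b _; rewrite mulrC.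
- rewrite exchange_big -sumrN /=; apply: eq_bigr => b _.
  have I_move x : B (A (e b)) (I x) = - B (I (A (e b))) x by rewrite I_skew opprK.
  under eq_bigr => a _ do rewrite A_comm I_move mulrN.
  by rewrite sumrN (parseval B_eucl _ _ e_basis) I_isometry.
- rewrite -sumrN /=; apply: eq_bigr => a _.
  have A_move b : B (A (e b)) (e a) = - B (A (e a)) (e b).
    by rewrite A_skew (euclC B_eucl).
  under eq_bigr => b _ do rewrite A_comm I_isometry A_move mulrN.
  by rewrite sumrN (parseval B_eucl _ _ e_basis).
Qed.

End Operator.

End Contraction.

(** Both sides are the trace of [L]; expanding in one basis and then in the other identifies
    them. *)
Lemma trace_form_indep (R : realType) (V : vectType R) (B B' : V -> V -> R)
    (e e' : 'I_(\dim {:V}) -> V) (L : 'End(V)) :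
    is_euclidean B -> orthonormal_basis B e ->
    is_euclidean B' -> orthonormal_basis B' e' ->
  \sum_i B (L (e i)) (e i) = \sum_i B' (L (e' i)) (e' i).
Proof.
move=> B_eucl [eO eE] B'_eucl [e'O e'E].
transitivity (\sum_i \sum_j B' (L (e i)) (e' j) * B (e' j) (e i)).
  apply: eq_bigr => i _; rewrite {1}(e'E (L (e i))) (eucl_suml B_eucl).
  by apply: eq_bigr => j _; rewrite (euclZl B_eucl).
rewrite exchange_big /=; apply: eq_bigr => j _.
transitivity (B' (L (\sum_i B (e' j) (e i) *: e i)) (e' j)); last by rewrite -eE.
rewrite linear_sum (eucl_suml B'_eucl) /=.
by apply: eq_bigr => i _; rewrite linearZ /= (euclZl B'_eucl) mulrC.
Qed.

(** * The Jacobi identity and the 4-form *)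

Section MomentMap.
Variables (R : realType) (k : lieAlgType R) (V : vectType R).
Variables (Bk : k -> k -> R) (rho : k -> 'End(V)) (BV : V -> V -> R).
Hypothesis Bk_inv : is_ad_invariant_euclidean Bk.
Hypothesis rho_rep : is_rep rho.
Hypothesis BV_eucl : is_euclidean BV.
Hypothesis BV_inv : is_invariant_form (fun x => rho x) BV.

Let Bk_eucl := Bk_inv.1.

Lemma rho_skew x v w : BV (rho x v) w = - BV v (rho x w).
Proof. by apply/eqP; rewrite -addr_eq0 BV_inv. Qed.

(** Condition (4) on the bracket of two vectors of [V]. *)
Definition is_moment_map (mu : V -> V -> k) :=
  forall a v w, Bk a (mu v w) = BV (rho a v) w.

Lemma moment_map_exists : exists mu, is_moment_map mu.
Proof.
have [f [_ fE]] := orthonormal_basis_exists Bk_eucl.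
exists (fun v w => \sum_i BV (rho (f i) v) w *: f i) => a v w.
rewrite (eucl_sumr Bk_eucl) [in RHS](fE a) (lin_sum (rep_linear rho_rep)).
rewrite sum_lfunE (eucl_suml BV_eucl); apply: eq_bigr => i _.
rewrite (euclZr Bk_eucl) (linZ (rep_linear rho_rep)) scale_lfunE.
by rewrite (euclZl BV_eucl) mulrC.
Qed.

Variable mu : V -> V -> k.
Hypothesis muP : is_moment_map mu.

Lemma moment_map_linear w : linear (mu^~ w).
Proof.
move=> c x y; apply: (eucl_inj Bk_eucl) => a.
rewrite (euclDr Bk_eucl) (euclZr Bk_eucl) !muP linearP.
by rewrite (euclDl BV_eucl) (euclZl BV_eucl).
Qed.

Lemma moment_map_skew v w : mu v w = - mu w v.
Proof.
apply: (eucl_inj Bk_eucl) => a; rewrite (euclNr Bk_eucl) !muP rho_skew.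
by rewrite (euclC BV_eucl).
Qed.

Lemma moment_map_equivariant x v w :
  mu (rho x v) w + mu v (rho x w) = lie x (mu v w).
Proof.
apply: (eucl_inj Bk_eucl) => a; rewrite (euclDr Bk_eucl) !muP.
have -> : Bk a (lie x (mu v w)) = Bk (lie a x) (mu v w).
  by rewrite (lieC a) (euclNl Bk_eucl) (lie_form Bk_inv) opprK.
rewrite muP (rho_lie_app rho_rep) (euclDl BV_eucl) (euclNl BV_eucl).
by rewrite (rho_skew x (rho a v)) opprK.
Qed.

Lemma cyclic_form_moment_map a b c d :
  cyclic_form Bk mu a b c d =
  BV (rho (mu a b) c + rho (mu b c) a + rho (mu c a) b) d.
Proof. by rewrite /cyclic_form !muP !(euclDl BV_eucl). Qed.

(** The Jacobi identity can fail only on three vectors of [V]: the other cases follow from that of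
    [k], the representation property and the equivariance of [mu]. *)
Lemma s_representation_of_cyclic_form :
    is_irreducible rho -> (forall a b c d, cyclic_form Bk mu a b c d = 0) ->
  is_s_representation Bk rho.
Proof.
move=> rho_irr mu0.
have rho_lin := rep_linear rho_rep.
have muC := moment_map_skew.
have mu_l := moment_map_linear.
have mu_r v : linear (mu v) by apply: mu_linear_r.
have jacobi_V a b c : rho (mu a b) c + rho (mu b c) a + rho (mu c a) b = 0.
  apply: (eucl_nondeg BV_eucl) => d.
  by rewrite -cyclic_form_moment_map mu0.
split=> //; exists BV.
exists (fun x y => (lie x.1 y.1 + mu x.2 y.2, rho x.1 y.2 - rho y.1 x.2)).
split=> //.
- split=> [y c x z|x y|a b|a v|v w|a v w] /=.
  + apply/eqP; rewrite xpair_eqE /= lie_linearl mu_l rho_lin linearP.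
    rewrite add_lfunE scale_lfunE scalerDr scalerBr opprD.
    by rewrite [X in (X == _) && _]addrACA [X in _ && (X == _)]addrACA !eqxx.
  + apply/eqP; rewrite xpair_eqE /= lieC muC opprD opprB.
    by rewrite !eqxx.
  + by rewrite (lin0 (mu_l 0)) addr0 (linear0 (rho a)) (linear0 (rho b)) subrr.
  + rewrite (lin0 (lie_linearr a)) (lin0 (mu_l v)) (lin0 rho_lin).
    by rewrite addr0 lfunE subr0.
  + by rewrite (lin0 rho_lin) !lfunE subrr.
  + by rewrite (lin0 (lie_linearl 0)) add0r.
(* In the [k] component equivariance makes the terms in [mu] cancel in pairs; in the [V] component
   the representation property leaves only the sum [jacobi_V]. *)
move=> [a u] [b v] [c w] /=; apply/eqP; rewrite xpair_eqE /=; apply/andP; split.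
  have lieD x y z : lie x (y + z) = lie x y + lie x z.
    exact: (linD (lie_linearr x)).
  have muB x y z : mu x (y - z) = mu x y - mu x z by exact: (linB (mu_r x)).
  rewrite !lieD -!moment_map_equivariant !muB.
  have J := lie_jacobi a b c.
  rewrite (muC (rho a v) w) (muC (rho b w) u) (muC (rho c u) v).
  apply/eqP/(eucl_nondeg Bk_eucl) => z.
  have := congr1 (Bk^~ z) J; rewrite (eucl0l Bk_eucl).
  by rewrite !(euclDl Bk_eucl) !(euclNl Bk_eucl); lra.
have rhoD x y z : rho (x + y) z = rho x z + rho y z by rewrite (linD rho_lin) lfunE.
have J := jacobi_V u v w.
rewrite !rhoD !(rho_lie_app rho_rep) !linearB /=.
apply/eqP/(eucl_nondeg BV_eucl) => z.
have := congr1 (BV^~ z) J; rewrite (eucl0l BV_eucl).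
rewrite !(euclDl BV_eucl) !(euclNl BV_eucl) !(euclDl BV_eucl) !(euclNl BV_eucl).
by lra.
Qed.

(** Jacobi on three vectors of [V] is minus the cyclic sum, the sign coming from skewness of
    [br]. *)
Lemma cyclic_form_s_bracket (br : k * V -> k * V -> k * V) :
    is_s_bracket Bk rho BV br -> satisfies_jacobi br ->
    (forall v w, mu v w = (br (0, v) (0, w)).1) ->
  forall a b c d, cyclic_form Bk mu a b c d = 0.
Proof.
move=> [_ br_skew _ br_kV br_VV _] br_jacobi muE a b c d.
rewrite cyclic_form_moment_map.
have brE u v w : br (0, u) (br (0, v) (0, w)) = (0, - rho (mu v w) u).
  rewrite muE; have := br_VV v w; case: (br (0, v) _) => z v' /= ->.
  by rewrite br_skew br_kV; congr (_, _); rewrite oppr0.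
have := br_jacobi (0, a) (0, b) (0, c); rewrite !brE => /(congr1 snd) /= J.
have -> : rho (mu a b) c + rho (mu b c) a + rho (mu c a) b = 0.
  by rewrite -[RHS]oppr0 -J !opprD !opprK -addrA addrC.
by rewrite (eucl0l BV_eucl).
Qed.

End MomentMap.

Lemma u1_coef_scalar (R : fieldType) : scalar (@u1_coef R).
Proof. by []. Qed.

(** * Extension of the representation by u(1) *)

Section UnitaryExtension.
Variables (R : realType) (h : lieAlgType R) (V : vectType R).
Variables (Bh : h -> h -> R) (rho : h -> 'End(V)) (I : 'End(V)).
Hypothesis Bh_inv : is_ad_invariant_euclidean Bh.
Hypothesis rho_rep : is_rep rho.
Hypothesis I_complex : is_invariant_complex_structure rho I.

Let rho_lin := rep_linear rho_rep.

Definition u1_form (r : R) := prod_form Bh (fun s t : u1 R => r * B_u1 s t).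

Lemma u1_form_invariant r : 0 < r -> is_ad_invariant_euclidean (u1_form r).
Proof.
move=> r_gt0; split; first split.
- move=> w a x y; rewrite /u1_form /prod_form (euclDl Bh_inv.1) (euclZl Bh_inv.1).
  by rewrite /B_u1 u1_coef_scalar; ring.
- move=> v w; rewrite /u1_form /prod_form (euclC Bh_inv.1) /B_u1.
  by rewrite [u1_coef _ * _]mulrC.
- move=> [x t]; rewrite xpair_eqE negb_and /u1_form /prod_form /B_u1 /u1_coef /=.
  have x_ge0 := eucl_ge0 Bh_inv.1 x.
  have t_ge0 : 0 <= r * (t * t) by rewrite mulr_ge0 ?(ltW r_gt0) // -expr2 sqr_ge0.
  case/orP => [x0|t0].
    by rewrite ltr_wpDr // (euclidean_pos Bh_inv.1).
  rewrite ltr_wpDl // mulr_gt0 // lt_def mulf_eq0 negb_or.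
  by rewrite (t0 : (t : R) != 0) -expr2 sqr_ge0.
- move=> x v w; rewrite /u1_form /prod_form /= /lie /= /prod_lie /=.
  rewrite (lie_form Bh_inv) /B_u1 /u1_coef /lie /= /u1_lie !mul0r !mulr0.
  by rewrite !addr0 addNr.
Qed.

(** The cross terms cancel since [I] commutes with [rho], the terms in the square of [I] since they
    are symmetric in the two coefficients. *)
Lemma extend_u1_rep : is_rep (extend_u1 rho I).
Proof.
split=> [a x y|x y]; rewrite /extend_u1 /=.
  by rewrite rho_lin /u1_coef /= !scalerDl scalerDr scalerA addrACA.
apply/lfunP => v.
rewrite /lie /= /u1_lie /u1_coef scale0r addr0 (rep_lie rho_rep).
rewrite !(add_lfunE, opp_lfunE, comp_lfunE, scale_lfunE) !linearD !linearZ /=.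
rewrite -!(complex_structure_comm I_complex) !(complex_structure_sqr I_complex).
set s := _ *: I _; set t := _ *: I _; set z := rho x.1 _; set w := rho y.1 _.
rewrite !scalerN !scalerA opprK -/s -/t; set q := _ *: v.
have -> : - w - t + (- s + q) = - w - (s + (t - q)).
  by rewrite !opprD opprK -addrA; congr (_ + _); rewrite addrCA.
by rewrite -(addrA z) addrACA subrr addr0.
Qed.

Lemma extend_u1_irreducible : is_irreducible rho -> is_irreducible (extend_u1 rho I).
Proof.
move=> [V0 V_irr]; split=> // U U_stable; apply: V_irr => x.
by have := U_stable (x, 0); rewrite /extend_u1 /u1_coef /= scale0r addr0.
Qed.

Section Form.
Variable BV : V -> V -> R.
Hypothesis BV_eucl : is_euclidean BV.
Hypothesis BV_inv : is_invariant_form (fun x => rho x) BV.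
Hypothesis I_skew : forall v w, BV (I v) w = - BV v (I w).

Lemma extend_u1_invariant : is_invariant_form (fun x => extend_u1 rho I x) BV.
Proof.
move=> x v w; rewrite /extend_u1 !add_lfunE !scale_lfunE.
rewrite (euclDl BV_eucl) (euclDr BV_eucl) (euclZl BV_eucl) (euclZr BV_eucl).
by rewrite I_skew (rho_skew BV_inv); ring.
Qed.

(** Testing on [(a, 0)] and [(0, 1)] separates the components; the scalar [r] enters only the
    second, through its inverse. *)
Lemma extend_u1_moment_map r (mu : V -> V -> h * u1 R) : 0 < r ->
  is_moment_map (u1_form r) (extend_u1 rho I) BV mu <->
  is_moment_map Bh rho BV (fun v w => (mu v w).1) /\
  (forall v w, u1_coef (mu v w).2 = r^-1 * BV (I v) w).
Proof.
move=> r_gt0; have r0 : r != 0 by rewrite gt_eqF.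
split=> [muP|[mu1 mu2] a v w].
  split=> [a v w|v w].
    have := muP (a, 0) v w; rewrite /u1_form /prod_form /extend_u1 /B_u1 /u1_coef /=.
    by rewrite mul0r mulr0 addr0 scale0r addr0.
  have := muP (0, 1 : R) v w.
  rewrite /u1_form /prod_form /extend_u1 /B_u1 /u1_coef /=.
  rewrite (eucl0l Bh_inv.1) (lin0 rho_lin) !add0r scale1r mul1r => <-.
  by rewrite mulKf.
rewrite /u1_form /prod_form /B_u1 mu1 mu2 /extend_u1 add_lfunE scale_lfunE.
rewrite (euclDl BV_eucl) (euclZl BV_eucl); congr (_ + _).
by rewrite mulrCA mulVKf.
Qed.

(** Valued in [R^o], so that it can take the place of [mu] in [cyclic_form]. *)
Definition omega (v w : V) : R^o := BV (I v) w.

(** The u(1) part carries the factor [r] from the form and [r^-1] from each of two moment maps. *)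
Lemma cyclic_form_u1 r (mu : V -> V -> h * u1 R) a b c d : 0 < r ->
  (forall v w, u1_coef (mu v w).2 = r^-1 * BV (I v) w) ->
  cyclic_form (u1_form r) mu a b c d =
  cyclic_form Bh (fun v w => (mu v w).1) a b c d
  + r^-1 * cyclic_form (fun x y : R^o => x * y) omega a b c d.
Proof.
move=> r_gt0 mu2; rewrite /cyclic_form /u1_form /prod_form /B_u1 !mu2 /omega.
by field; rewrite gt_eqF.
Qed.

Section Contract.
Variables (e : 'I_(\dim {:V}) -> V) (f : 'I_(\dim {:h}) -> h).
Hypothesis e_basis : orthonormal_basis BV e.
Hypothesis f_basis : orthonormal_basis Bh f.
Hypothesis h_semisimple : is_semisimple h.

(** By perfectness it suffices to treat brackets, on which the sum is [- 2 Q]. *)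
Lemma trace_rho_I x : \sum_a BV (rho x (e a)) (I (e a)) = 0.
Proof.
apply: (perfect h_semisimple Bh_inv
  (phi := fun x => \sum_a BV (rho x (e a)) (I (e a)))) => [c {}x y|{}x y].
  rewrite mulr_sumr -big_split; apply: eq_bigr => a _ /=.
  by rewrite rho_lin add_lfunE scale_lfunE (euclDl BV_eucl) (euclZl BV_eucl).
pose Q := \sum_a BV (rho y (e a)) (I (rho x (e a))).
have QE : Q = \sum_a \sum_b BV (rho y (e a)) (e b) * BV (I (rho x (e a))) (e b).
  by apply: eq_bigr => a _; rewrite (parseval BV_eucl _ _ e_basis).
have Q0 : Q = 0.
  (* Exchanging the two basis indices and moving [rho x], [rho y] and [I] across the product
     reverses the sign. *)
  suff : Q = - Q by lra.
  rewrite {1}QE exchange_big QE -sumrN; apply: eq_bigr => b _.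
  rewrite -sumrN; apply: eq_bigr => a _.
  have -> : BV (rho y (e a)) (e b) = - BV (rho y (e b)) (e a).
    by rewrite (rho_skew BV_inv) (euclC BV_eucl).
  rewrite mulNr I_skew (rho_skew BV_inv _ (e a) (I _)) opprK.
  by rewrite -(complex_structure_comm I_complex) (euclC BV_eucl (e a)).
transitivity (- (Q *+ 2)); last by rewrite Q0 mul0rn oppr0.
rewrite /Q -sumrMnl -sumrN; apply: eq_bigr => a _.
rewrite (rho_lie_app rho_rep) (euclDl BV_eucl) (euclNl BV_eucl).
have -> : BV (rho x (rho y (e a))) (I (e a)) = - BV (rho y (e a)) (I (rho x (e a))).
  by rewrite (rho_skew BV_inv) -(complex_structure_comm I_complex).
have -> : BV (rho y (rho x (e a))) (I (e a)) = BV (rho y (e a)) (I (rho x (e a))).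
  rewrite (rho_skew BV_inv) -(complex_structure_comm I_complex) -I_skew.
  exact: euclC.
by rewrite mulr2n opprD.
Qed.

(** The trace of the Casimir operator, the sum of the squares of the [rho (f i)]. *)
Definition casimir_trace := \sum_i \sum_a BV (rho (f i) (rho (f i) (e a))) (e a).

(** Splitting [mu] along [f] gives one operator [rho (f i)] per summand; [trace_rho_I] kills the
    squared trace in each. *)
Lemma contraction_h (mu : V -> V -> h) : is_moment_map Bh rho BV mu ->
  contraction I e (cyclic_form Bh mu) = casimir_trace *+ 2.
Proof.
move=> muP.
have muf x y z t : Bh (mu x y) (mu z t) =
    \sum_i BV (rho (f i) x) y * BV (rho (f i) z) t.
  rewrite -(parseval Bh_inv.1 _ _ f_basis); apply: eq_bigr => i _.
  by rewrite !(euclC Bh_inv.1 _ (f i)) !muP.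
transitivity (\sum_i contraction I e (fun a b c d =>
    BV (rho (f i) a) b * BV (rho (f i) c) d
    + BV (rho (f i) b) c * BV (rho (f i) a) d
    + BV (rho (f i) c) a * BV (rho (f i) b) d)).
  rewrite /contraction [RHS]exchange_big /=; apply: eq_bigr => a _.
  rewrite [RHS]exchange_big /=; apply: eq_bigr => b _.
  by rewrite /cyclic_form !muf -!big_split.
rewrite /casimir_trace -sumrMnl; apply: eq_bigr => i _.
have II := complex_structure_sqr I_complex.
rewrite (contraction_operator BV_eucl e_basis II I_skew).
- rewrite trace_rho_I expr0n /= sub0r -mulNrn -sumrN; congr (_ *+ 2).
  by apply: eq_bigr => a _; rewrite -(rho_skew BV_inv).
- by move=> v w; apply: (rho_skew BV_inv).
- by move=> v; rewrite (complex_structure_comm I_complex).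
Qed.

Lemma contraction_omega :
  contraction I e (cyclic_form (fun x y : R^o => x * y) omega) =
  (\dim {:V})%:R ^+ 2 - (\dim {:V})%:R *+ 2.
Proof.
have II := complex_structure_sqr I_complex.
rewrite -[LHS]/(contraction I e (fun a b c d =>
   BV (I a) b * BV (I c) d + BV (I b) c * BV (I a) d + BV (I c) a * BV (I b) d)).
rewrite (contraction_operator BV_eucl e_basis II I_skew) //.
have -> : \sum_a BV (I (e a)) (I (e a)) = (\dim {:V})%:R.
  under eq_bigr => a _ do rewrite (I_isometry BV_eucl II I_skew) e_basis.1 eqxx.
  by rewrite sumr_const card_ord.
by [].
Qed.

(** It is minus the sum of the squared norms of the [rho (f i) (e a)]. If it were zero, [rho] would
    vanish and every line would be stable. *)
Lemma casimir_trace_lt0 :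
  is_irreducible rho -> (1 < \dim {:V})%N -> casimir_trace < 0.
Proof.
move=> [_ V_irr] V1.
have -> : casimir_trace =
    - \sum_i \sum_a BV (rho (f i) (e a)) (rho (f i) (e a)).
  rewrite -sumrN; apply: eq_bigr => i _; rewrite -sumrN.
  by apply: eq_bigr => a _; rewrite (rho_skew BV_inv).
have N_ge0 i : 0 <= \sum_a BV (rho (f i) (e a)) (rho (f i) (e a)).
  by apply: sumr_ge0 => a _; apply: eucl_ge0.
rewrite oppr_lt0 lt_def sumr_ge0 // andbT; apply/eqP => /psumr_eq0P N0.
have rho0 x v : rho x v = 0.
  rewrite (f_basis.2 x) (lin_sum rho_lin) sum_lfunE big1 // => i _.
  rewrite (linZ rho_lin) scale_lfunE (e_basis.2 v) linear_sum big1 ?scaler0 //.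
  move=> a _; rewrite linearZ /=.
  have /psumr_eq0P Na := N0 (fun i _ => N_ge0 i) i isT.
  have /eqP := Na (fun a _ => eucl_ge0 BV_eucl _) a isT.
  by rewrite (eucl_eq0 BV_eucl) => /eqP ->; rewrite scaler0.
pose v := vpick {:V}.
have v0 : v != 0 by rewrite vpick0 -dimv_eq0 -lt0n ltnW.
have [x||vT] := V_irr <[v]>%VS.
- by apply/subvP => _ /memv_imgP[w _ ->]; rewrite rho0 mem0v.
- by apply/eqP; rewrite -dimv_eq0 dim_vline v0.
- by move: V1; rewrite -vT dim_vline v0.
Qed.

End Contract.
End Form.
End UnitaryExtension.

Lemma ext_rep_linear (R : numFieldType) (g : lieAlgType R) (V : vectType R) k
    (rho : g -> 'End(V)) : linear rho -> linear (ext_rep k rho).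
Proof.
move=> rho_lin a x y; apply/lfunP; apply: ext_power_eq => v.
rewrite /= add_lfunE scale_lfunE /ext_rep !ext_der_wedge scaler_sumr -big_split.
apply: eq_bigr => i _ /=.
by rewrite rho_lin add_lfunE scale_lfunE wedge_multilinear.
Qed.

Lemma cyclic_4form_tuple (R : realType) (V K : vectType R) (B : K -> K -> R)
    (mu : V -> V -> K) (a b c d : V) :
  cyclic_4form B mu [ffun i : 'I_4 => nth 0 [:: a; b; c; d] i] =
  cyclic_form B mu a b c d.
Proof. by rewrite /cyclic_4form !ffunE !inordK. Qed.

Lemma mul_euclidean (R : realType) : is_euclidean (fun x y : R^o => x * y : R).
Proof.
split=> [w a x y|v w|v v0]; first by rewrite mulrDl -mulrA.
  exact: mulrC.
by rewrite lt_def mulf_eq0 negb_or v0 -expr2 sqr_ge0.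
Qed.

(** * Proportionality of the two invariant 4-forms *)

Section Proportionality.
Variables (R : realType) (h : lieAlgType R) (V : vectType R).
Variables (Bh : h -> h -> R) (rho : h -> 'End(V)) (I : 'End(V)).
Hypothesis Bh_inv : is_ad_invariant_euclidean Bh.
Hypothesis rho_rep : is_rep rho.
Hypothesis I_complex : is_invariant_complex_structure rho I.
Variable BV : V -> V -> R.
Hypothesis BV_eucl : is_euclidean BV.
Hypothesis BV_inv : is_invariant_form (fun x => rho x) BV.
Hypothesis I_skew : forall v w, BV (I v) w = - BV v (I w).
Variable mu : V -> V -> h.
Hypothesis muP : is_moment_map Bh rho BV mu.
Hypothesis dim_invariants :
  \dim (invariants (ext_rep 4 (extend_u1 rho I))) = 1%N.

Let T0 := cyclic_4form Bh mu.
Let T1 := cyclic_4form (fun x y : R^o => x * y) (omega I BV).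

Let mu_lin := moment_map_linear Bh_inv BV_eucl muP.
Let mu_skew := moment_map_skew Bh_inv BV_eucl BV_inv muP.

Let omega_lin w : linear ((omega I BV)^~ w).
Proof.
by move=> a x y; rewrite /omega linearP (euclDl BV_eucl) (euclZl BV_eucl).
Qed.

Let omega_skew v w : omega I BV v w = - omega I BV w v.
Proof. by rewrite /omega I_skew (euclC BV_eucl). Qed.

Lemma moment_map_I_invariant u v : mu (I u) v + mu u (I v) = 0.
Proof.
apply: (eucl_inj Bh_inv.1) => a; rewrite (euclDr Bh_inv.1) !muP.
rewrite -(complex_structure_comm I_complex) I_skew (eucl0r Bh_inv.1).
exact: addNr.
Qed.

(** The values of [mu] lie in [h], on which u(1) acts trivially, so the derivation is [lie x.1]
    alone. *)
Lemma h_4form_invariant x v :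
  \sum_i T0 (upd v i (extend_u1 rho I x (v i))) = 0.
Proof.
apply: (cyclic_4form_invariant Bh_inv.1 (D := lie x.1)) => [y z|u w].
  exact: Bh_inv.2.
have mur z : linear (mu z) by apply: mu_linear_r.
rewrite /extend_u1 !add_lfunE !scale_lfunE (linD (mu_lin w)) (linZ (mu_lin w)).
rewrite (linD (mur u)) (linZ (mur u)) addrACA -scalerDr moment_map_I_invariant.
by rewrite scaler0 addr0 (moment_map_equivariant Bh_inv rho_rep BV_eucl BV_inv muP).
Qed.

Lemma omega_4form_invariant x v :
  \sum_i T1 (upd v i (extend_u1 rho I x (v i))) = 0.
Proof.
apply: (cyclic_4form_invariant (mul_euclidean R) (D := fun _ => 0)) => [y z|u w].
  by rewrite mul0r mulr0 addr0.
rewrite /omega.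
have -> : I (extend_u1 rho I x u) = extend_u1 rho I x (I u).
  rewrite /extend_u1 !add_lfunE !scale_lfunE linearD linearZ /=.
  by rewrite (complex_structure_comm I_complex).
exact: (extend_u1_invariant BV_eucl BV_inv I_skew).
Qed.

(** In dimension at most 2 the fourth exterior power is zero and has no nonzero invariants. The
    bound makes [n^2 - 2 n] positive. *)
Lemma dim_gt2 : (2 < \dim {:V})%N.
Proof.
rewrite ltnNge; apply/negP => V2.
have w0 := ext_power_eq0 (leq_ltn_trans V2 (isT : (2 < 4)%N)).
have : invariants (ext_rep 4 (extend_u1 rho I)) = 0%VS.
  by apply/eqP; rewrite -vpick0; apply/eqP; apply: w0.
by move=> U0; move: dim_invariants; rewrite U0 dimv0.
Qed.

Lemma dim_poly_gt0 : 0 < (\dim {:V})%:R ^+ 2 - (\dim {:V})%:R *+ 2 :> R.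
Proof.
have : 2 < (\dim {:V})%:R :> R by rewrite ltr_nat dim_gt2.
move: ((\dim {:V})%:R : R) => n n2; rewrite expr2 -mulr_natr; nra.
Qed.

(** [sharp] places both forms on the line of invariants, and its injectivity on alternating forms
    brings the relation back. *)
Lemma h_4form_proportional : exists c : R, forall a b x y,
  cyclic_form Bh mu a b x y =
  c * cyclic_form (fun s t : R^o => s * t) (omega I BV) a b x y.
Proof.
have [e e_basis] := orthonormal_basis_exists BV_eucl.
have T0_lin : is_multilinear T0 := cyclic_4form_multilinear Bh_inv.1 mu_lin mu_skew.
have T1_lin : is_multilinear T1 :=
  cyclic_4form_multilinear (mul_euclidean R) omega_lin omega_skew.
have T0_alt : is_alternating T0 := cyclic_4form_alternating Bh_inv.1 mu_skew.
have T1_alt : is_alternating T1 :=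
  cyclic_4form_alternating (mul_euclidean R) omega_skew.
have ext_lin := ext_rep_linear 4 (rep_linear (extend_u1_rep rho_rep I_complex)).
have skew x u v : BV (extend_u1 rho I x u) v = - BV u (extend_u1 rho I x v).
  by apply: (rho_skew (extend_u1_invariant BV_eucl BV_inv I_skew)).
have S0_inv : sharp e T0 \in invariants (ext_rep 4 (extend_u1 rho I)).
  apply/invariantsP => // x.
  exact: (sharp_invariant BV_eucl e_basis T0_lin (skew x) (h_4form_invariant x)).
have S1_inv : sharp e T1 \in invariants (ext_rep 4 (extend_u1 rho I)).
  apply/invariantsP => // x.
  exact: (sharp_invariant BV_eucl e_basis T1_lin (skew x) (omega_4form_invariant x)).
(* Otherwise [T1] would vanish, against its positive contraction. *)
have S1_neq0 : sharp e T1 != 0.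
  apply/eqP => /(sharp_eq0 e_basis T1_lin T1_alt) T1_0.
  have := dim_poly_gt0.
  rewrite -(contraction_omega I_complex BV_eucl I_skew e_basis) /contraction.
  rewrite big1 ?ltxx // => i _; rewrite big1 // => j _.
  by rewrite -cyclic_4form_tuple; apply: T1_0.
have [c Sc] := dim1_colinear dim_invariants S0_inv S1_inv S1_neq0.
exists c => a b x y.
pose T : {ffun 'I_4 -> V} -> R^o := fun v => T0 v - c * T1 v.
have T_lin : is_multilinear T.
  move=> v i k z w; rewrite /T T0_lin T1_lin /= -![_ *: _]/(_ * _); ring.
have T_alt : is_alternating T.
  move=> v i j ij vij.
  by rewrite /T (T0_alt _ _ _ ij vij) (T1_alt _ _ _ ij vij) mulr0 subrr.
have T_0 : sharp e T = 0 by rewrite sharpB Sc subrr.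
have := sharp_eq0 e_basis T_lin T_alt T_0 [ffun i : 'I_4 => nth 0 [:: a; b; x; y] i].
by rewrite /T /T0 /T1 !cyclic_4form_tuple => /eqP; rewrite subr_eq0 => /eqP.
Qed.

End Proportionality.

(** * Existence and uniqueness of the scalar r *)

Theorem proposition2p8 (R : realType) (h : lieAlgType R) (m : vectType R)
    (Bh : h -> h -> R) (rho : h -> 'End(m)) (I : 'End(m))
    (h_semisimple : is_semisimple h)
    (Bh_euclidean : is_ad_invariant_euclidean Bh)
    (rho_rep : is_rep rho)
    (rho_faithful : is_faithful rho)
    (rho_irreducible : is_irreducible rho)
    (rho_complex : is_complex_type rho)
    (I_complex : is_invariant_complex_structure rho I)
    (dim_invariants :
      \dim (invariants (ext_rep 4 (extend_u1 rho I))) = 1%N) :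
  exists! r : R, 0 < r /\
    is_s_representation
      (prod_form Bh (fun s t : u1 R => r * B_u1 s t))
      (extend_u1 rho I).
Proof.
have [BV [BV_eucl BV_inv]] := invariant_euclidean_exists h_semisimple Bh_euclidean
  rho_rep rho_irreducible rho_complex I_complex.
have skew B' : is_euclidean B' -> is_invariant_form (fun x => rho x) B' ->
    forall v w, B' (I v) w = - B' v (I w).
  exact: (complex_structure_skew rho_irreducible rho_complex I_complex).
have I_skew := skew _ BV_eucl BV_inv.
have [e e_basis] := orthonormal_basis_exists BV_eucl.
have [f f_basis] := orthonormal_basis_exists Bh_euclidean.1.
have [mu muP] := moment_map_exists Bh_euclidean rho_rep BV_eucl.
pose N : R := (\dim {:m})%:R ^+ 2 - (\dim {:m})%:R *+ 2.
have N_gt0 : 0 < N := dim_poly_gt0 dim_invariants.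
pose cas := casimir_trace rho BV e f.
have cas_lt0 : cas < 0.
  apply: (casimir_trace_lt0 rho_rep BV_eucl BV_inv e_basis f_basis) => //.
  by apply: ltn_trans (dim_gt2 dim_invariants).
have ext_rho := extend_u1_rep rho_rep I_complex.
have [c cE] := h_4form_proportional Bh_euclidean rho_rep I_complex BV_eucl BV_inv
  I_skew muP dim_invariants.
(* The contraction of the relation [cE]; its two sides fix the sign of [c]. *)
have casE : cas *+ 2 = c * N.
  rewrite -(contraction_h Bh_euclidean rho_rep I_complex BV_eucl BV_inv I_skew
    e_basis f_basis h_semisimple muP).
  rewrite /N -(contraction_omega I_complex BV_eucl I_skew e_basis) /contraction.
  rewrite mulr_sumr; apply: eq_bigr => a _; rewrite mulr_sumr.
  by apply: eq_bigr => b _; apply: cE.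
have c_lt0 : c < 0.
  by move: cas_lt0; rewrite -(pmulrn_llt0 _ (isT : 0 < 2)%N) casE pmulr_llt0.
(* The total 4-form is [c + r^-1] times that of [omega], hence vanishes for this value. *)
exists (- c^-1); split.
  have r_gt0 : 0 < - c^-1 by rewrite oppr_gt0 invr_lt0.
  split=> //.
  have form_inv := u1_form_invariant Bh_euclidean r_gt0.
  have ext_inv := extend_u1_invariant BV_eucl BV_inv I_skew.
  pose mu' v w : h * u1 R := (mu v w, (- c^-1)^-1 * BV (I v) w).
  have mu'P : is_moment_map (u1_form Bh (- c^-1)) (extend_u1 rho I) BV mu'.
    by apply/(extend_u1_moment_map I Bh_euclidean rho_rep BV_eucl mu' r_gt0).
  apply: (s_representation_of_cyclic_form form_inv ext_rho BV_eucl ext_inv mu'P).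
    exact: extend_u1_irreducible.
  move=> a b x y; rewrite (cyclic_form_u1 Bh (I := I) (BV := BV) _ _ _ _ r_gt0) //.
  by rewrite cE invrN invrK mulNr subrr.
(* The product [BV'] and the bracket come with [r'] and need not be those above, so the contraction
   is redone for them. *)
move=> r' [r'_gt0 [form_inv _ _ [BV' [br [BV'_eucl ext_inv br_s br_jacobi]]]]].
have BV'_inv : is_invariant_form (fun x => rho x) BV'.
  move=> x v w; have := ext_inv (x, 0) v w.
  by rewrite /extend_u1 /u1_coef /= scale0r addr0.
have I_skew' := skew _ BV'_eucl BV'_inv.
pose mu' v w := (br (0, v) (0, w)).1.
have mu'P : is_moment_map (u1_form Bh r') (extend_u1 rho I) BV' mu'.
  by move=> a v w; apply: (s_bracket_form br_s).
have mu'0 := cyclic_form_s_bracket BV'_eucl mu'P br_s br_jacobi (fun _ _ => erefl).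
have [mu1P mu2E] :=
  (extend_u1_moment_map I Bh_euclidean rho_rep BV'_eucl mu' r'_gt0).1 mu'P.
have [e' e'_basis] := orthonormal_basis_exists BV'_eucl.
(* The Casimir trace is that of an operator, so it is the same for [BV'] and [BV]. *)
have cas'E : casimir_trace rho BV' e' f = cas.
  apply: eq_bigr => i _.
  have := trace_form_indep (rho (f i) \o rho (f i))%VF
    BV'_eucl e'_basis BV_eucl e_basis.
  by under eq_bigr do rewrite comp_lfunE; under [RHS]eq_bigr do rewrite comp_lfunE.
(* Contraction of the vanishing total 4-form; with [casE] it determines [r']. *)
have E' : cas *+ 2 + r'^-1 * N = 0.
  rewrite -cas'E.
  rewrite -(contraction_h Bh_euclidean rho_rep I_complex BV'_eucl BV'_inv I_skew'
    e'_basis f_basis h_semisimple mu1P).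
  rewrite /N -(contraction_omega I_complex BV'_eucl I_skew' e'_basis) /contraction.
  rewrite mulr_sumr -big_split big1 // => a _ /=.
  rewrite mulr_sumr -big_split big1 // => b _ /=.
  by rewrite -(cyclic_form_u1 Bh _ _ _ _ r'_gt0 mu2E).
have : r'^-1 = - c.
  have : (r'^-1 + c) * N = 0 by rewrite mulrDl -casE addrC.
  by move/eqP; rewrite mulf_eq0 (gt_eqF N_gt0) orbF addr_eq0 => /eqP.
by move=> rc; rewrite -[r']invrK rc invrN.
Qed.
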